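(* Let $T(x,t)$ (with auxiliary functions $\zeta_1(t),\dots,\zeta_N(t)$) be the solution of the reduced problem $$\left\{\begin{aligned} &T_t+aT_{tt}=K\left(T_{xx}+bT_{txx}\right)+F(x,t),\quad (x,t)\in[0,x_r]\times(0,D],\\ &T(x,0)=\xi_1(x),\quad T_t(x,0)=\eta_1(x),\quad x\in[0,x_r],\\ &T(0,t)=0,\quad t\in(0,D],\\ &T_x(x_r,t)+bT_{tx}(x_r,t)+\sqrt{\tfrac{z_0}{K}}\Big[\Big(1+\sum_{n=1}^N\tfrac{a_n}{b_n}\Big)T_t(x_r,t)-z_0\sum_{n=1}^N\tfrac{a_n}{b_n}\zeta_n'(t)\Big]=Q(t),\quad t\in(0,D],\\ &(z_0-b_nz_0)\zeta_n'(t)+b_n\left[\zeta_n(t)+(a+b)\zeta_n'(t)+ab\,\zeta_n''(t)\right]=T_t(x_r,t)+R(t),\quad t\in(0,D],\ 1\le n\le N,\\ &\zeta_n(0)=\zeta_n'(0)=0,\quad n=1,\dots,N, \end{aligned}\right.$$ and let $\{\bar T_i^k\mid 0\le i\le M_s,\ 0\le k\le M_t\}$ (together with grid functions $\bar W_i^k$ and sequences $Z_n^k,\sigma_n^k$) be the solution of the finite difference scheme $$\left\{\begin{aligned} &\bar W_i^{k-\frac12}+a\delta_t\bar W_i^{k-\frac12}=K\left(\delta_x^2\bar T_i^{k-\frac12}+b\,\delta_x^2\bar W_i^{k-\frac12}\right)+F_i^{k-\frac12},\quad 1\le i\le M_s-1,\ 1\le k\le M_t,\\ &\bar T_i^0=\xi_1(x_i),\quad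 \bar W_i^0=\eta_1(x_i),\quad 0\le i\le M_s,\\ &\bar T_0^{k-\frac12}=0,\quad 1\le k\le M_t,\\ &\bar W_{M_s}^{k-\frac12}+a\delta_t\bar W_{M_s}^{k-\frac12}=\frac{2K}{h}\Big\{-\delta_x\bar T_{M_s-\frac12}^{k-\frac12}-b\,\delta_x\bar W_{M_s-\frac12}^{k-\frac12}-\sqrt{\tfrac{z_0}{K}}\Big[\Big(1+\sum_{n=1}^N\tfrac{a_n}{b_n}\Big)\bar W_{M_s}^{k-\frac12}-z_0\sum_{n=1}^N\tfrac{a_n}{b_n}\sigma_n^{k-\frac12}\Big]+Q^{k-\frac12}\Big\}\\ &\qquad+F_{M_s}^{k-\frac12},\quad 1\le k\le M_t,\\ &(z_0-b_nz_0)\sigma_n^{k-\frac12}+b_n\left[Z_n^{k-\frac12}+(a+b)\sigma_n^{k-\frac12}+ab\,\delta_t\sigma_n^{k-\frac12}\right]=\bar W_{M_s}^{k-\frac12}+R^{k-\frac12},\quad 1\le n\le N,\ 1\le k\le M_t,\\ &Z_n^0=\sigma_n^0=0,\quad n=1,\dots,N,\\ &\delta_x\bar W_{i-\frac12}^{k-\frac12}-\delta_x\delta_t\bar T_{i-\frac12}^{k-\frac12}=0,\quad 1\le i\le M_s,\ 1\le k\le M_t,\\ &\sigma_n^{k-\frac12}-\delta_tZ_n^{k-\frac12}=0,\quad 1\le n\le N,\ 1\le k\le M_t. \end{aligned}\right.$$ Put $\bar e_i^k=T(x_i,t_k)-\bar T_i^k$ for $0\le i\le M_s$, $0\le k\le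 M_t$. Then there is a positive constant $C$, independent of $\Delta t$, $h$ and $m$, such that $$\|\bar e^m\|_\infty^2\le C\left(\Delta t^4+h^4\right),\qquad 1\le m\le M_t.$$
   Context: $a,b,K,D,x_r,z_0>0$ are given constants, $N\ge1$ is an integer, and for $n=1,\dots,N$, $b_n=\cos^2\left(\frac{n\pi}{2N+1}\right)$, $a_n=\frac{2}{2N+1}\sin^2\left(\frac{n\pi}{2N+1}\right)$. Subscripts $t,x$ on functions denote partial derivatives. Data: given continuous functions $f(x,t)$ supported in $[0,x_r]\times[0,D]$, $\xi(x),\eta(x)$ supported in $[0,x_r]$, and $\phi(t)$ (with continuous $\phi',\phi''$), set $F(x,t)=f(x,t)-\phi'(t)-a\phi''(t)$, $\xi_1(x)=\xi(x)-\phi(0)$, $\eta_1(x)=\eta(x)-\phi'(0)$, $Q(t)=-\sqrt{z_0/K}\,\big(1+\sum_{n=1}^Na_n/b_n\big)\phi'(t)$, $R(t)=\phi'(t)$. Grid: $M_t,M_s$ are positive integers, $\Delta t=D/M_t$, $h=x_r/M_s$, $t_k=k\Delta t$, $x_i=ih$. For a grid function $v=\{v_i^k\}$: $v_i^{k-\frac12}=\frac12(v_i^k+v_i^{k-1})$, $\delta_tv_i^{k-\frac12}=(v_i^k-v_i^{k-1})/\Delta t$, $\delta_xv_{i-\frac12}^k=(v_i^k-v_{i-1}^k)/h$, $\delta_x^2v_i^k=(\delta_xv_{i+\frac12}^k-\delta_xv_{i-\frac12}^k)/h$, $\delta_x\delta_tv_{i-\frac12}^{k-\frac12}=(\delta_tv_i^{k-\frac12}-\delta_tv_{i-1}^{k-\frac12})/h$;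 the same notation is used for sequences depending on $k$ only and with $k$ replaced by $k-\frac12$. Functions $F,Q,R,\xi_1,\eta_1$ are identified with their grid values, e.g. $F_i^k=F(x_i,t_k)$, $Q^k=Q(t_k)$, $R^k=R(t_k)$. For $u=(u_i)_{0\le i\le M_s}$, $\|u\|_\infty=\max_{0\le i\le M_s}|u_i|$. Standing conventions: $\bar T^k$ and $\bar W^k$ lie in $V=\{v\mid v_0=0\}$, i.e. $\bar T_0^k=\bar W_0^k=0$ for $0\le k\le M_t$ (in particular $\xi_1(0)=\eta_1(0)=0$). The exact solution is assumed sufficiently smooth for second-order Taylor truncation estimates, e.g. $T$ has continuous partial derivatives up to total order 5 on $[0,x_r]\times[0,D]$ and $\zeta_n\in C^4[0,D]$. The constant $C$ may depend on the exact solution and on $a,b,K,D,x_r,z_0,N$. *)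

(* Defs.v *)
From Stdlib Require Import Reals List RList.
From Coquelicot Require Import Coquelicot.
Open Scope R_scope.

(** * Derivatives on closed intervals and rectangles *)

(* The filter is restricted to [lo, hi], so the derivative is one-sided at the
   endpoints, and nothing is asked of [f] outside the interval. *)
Definition is_derive_within (lo hi : R) (f : R -> R) (x l : R) : Prop :=
  filterdiff f (within (fun y => lo <= y <= hi) (locally x))
    (fun y => scal y l).

Definition ex_derive_within (lo hi : R) (f : R -> R) (x : R) : Prop :=
  exists l, is_derive_within lo hi f x l.

(* Total operator in the style of [RInt]; meaningful only for [lo < hi],
   [lo <= x <= hi] and [ex_derive_within lo hi f x]. *)
Definition Derive_within (lo hi : R) (f : R -> R) (x : R) : R :=
  iota (is_derive_within lo hi f x).

Definition partial_x (x_r : R) (u : R -> R -> R) (x t : R) : R :=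
  Derive_within 0 x_r (fun y => u y t) x.

Definition partial_t (D : R) (u : R -> R -> R) (x t : R) : R :=
  Derive_within 0 D (fun s => u x s) t.

(* [f] is of class C^n on [lo, hi]. *)
Fixpoint C_interval (n : nat) (lo hi : R) (f : R -> R) : Prop :=
  continuous_on (fun x => lo <= x <= hi) f /\
  match n with
  | O => True
  | S n' =>
      (forall x, lo <= x <= hi -> ex_derive_within lo hi f x) /\
      C_interval n' lo hi (Derive_within lo hi f)
  end.

(* [u] has continuous partial derivatives, mixed ones in any order included,
   up to total order [n] on [0, x_r] x [0, D]. *)
Fixpoint C_rectangle (n : nat) (x_r D : R) (u : R -> R -> R) : Prop :=
  continuous_on (fun p : R * R => 0 <= fst p <= x_r /\ 0 <= snd p <= D)
    (fun p => u (fst p) (snd p)) /\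
  match n with
  | O => True
  | S n' =>
      (forall x t, 0 <= x <= x_r -> 0 <= t <= D ->
         ex_derive_within 0 x_r (fun y => u y t) x /\
         ex_derive_within 0 D (fun s => u x s) t) /\
      C_rectangle n' x_r D (partial_x x_r u) /\
      C_rectangle n' x_r D (partial_t D u)
  end.

(** * Coefficients and transformed data *)

Definition coef_b (N n : nat) : R :=
  (cos (INR n * PI / INR (2 * N + 1))) ^ 2.

Definition coef_a (N n : nat) : R :=
  2 / INR (2 * N + 1) * (sin (INR n * PI / INR (2 * N + 1))) ^ 2.

Definition sum_ab (N : nat) : R :=
  sum_n_m (fun n => coef_a N n / coef_b N n) 1 N.

Definition data_F (a D : R) (f : R -> R -> R) (phi : R -> R) (x t : R) : R :=
  f x t - Derive_within 0 D phi t
    - a * Derive_within 0 D (Derive_within 0 D phi) t.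

Definition data_xi1 (xi phi : R -> R) (x : R) : R := xi x - phi 0.

Definition data_eta1 (D : R) (eta phi : R -> R) (x : R) : R :=
  eta x - Derive_within 0 D phi 0.

Definition data_Q (K D z0 : R) (N : nat) (phi : R -> R) (t : R) : R :=
  - sqrt (z0 / K) * (1 + sum_ab N) * Derive_within 0 D phi t.

Definition data_R (D : R) (phi : R -> R) (t : R) : R := Derive_within 0 D phi t.

(** * The reduced problem *)

Record reduced_problem (a b K D x_r z0 : R) (N : nat)
    (F : R -> R -> R) (xi1 eta1 Q Rt : R -> R)
    (T : R -> R -> R) (zeta : nat -> R -> R) : Prop := {
  rp_heat : forall x t, 0 <= x <= x_r -> 0 < t <= D ->
    partial_t D T x t + a * partial_t D (partial_t D T) x t
    = K * (partial_x x_r (partial_x x_r T) x t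
           + b * partial_x x_r (partial_x x_r (partial_t D T)) x t)
      + F x t;
  rp_init : forall x, 0 <= x <= x_r -> T x 0 = xi1 x;
  rp_init_t : forall x, 0 <= x <= x_r -> partial_t D T x 0 = eta1 x;
  rp_left : forall t, 0 < t <= D -> T 0 t = 0;
  rp_right : forall t, 0 < t <= D ->
    partial_x x_r T x_r t + b * partial_x x_r (partial_t D T) x_r t
    + sqrt (z0 / K) *
        ((1 + sum_ab N) * partial_t D T x_r t
         - z0 * sum_n_m (fun n => coef_a N n / coef_b N n
                               * Derive_within 0 D (zeta n) t) 1 N)
    = Q t;
  rp_zeta : forall n t, (1 <= n <= N)%nat -> 0 < t <= D ->
    (z0 - coef_b N n * z0) * Derive_within 0 D (zeta n) t
    + coef_b N n *
        (zeta n t + (a + b) * Derive_within 0 D (zeta n) t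
         + a * b * Derive_within 0 D (Derive_within 0 D (zeta n)) t)
    = partial_t D T x_r t + Rt t;
  rp_zeta_init : forall n, (1 <= n <= N)%nat ->
    zeta n 0 = 0 /\ Derive_within 0 D (zeta n) 0 = 0
}.

(** * The finite difference scheme *)

(* A half-integer index k - 1/2 is encoded by the integer k >= 1. *)
Definition mid (v : nat -> R) (k : nat) : R := (v k + v (k - 1)%nat) / 2.

(* The difference quotient with step [s] at index k - 1/2: this is delta_t for
   [s] the time step and delta_x for [s] the space step. *)
Definition delta (s : R) (v : nat -> R) (k : nat) : R :=
  (v k - v (k - 1)%nat) / s.

Definition delta2 (h : R) (v : nat -> R) (i : nat) : R :=
  (delta h v (S i) - delta h v i) / h.

Definition sup_norm (M : nat) (u : nat -> R) : R :=
  MaxRlist (map (fun i => Rabs (u i)) (seq 0 (S M))).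

(* Grid functions take the space index first: [Tb i k] is the value at
   (i h, k tau). *)
Record fd_scheme (a b K D x_r z0 : R) (N : nat)
    (F : R -> R -> R) (xi1 eta1 Q Rt : R -> R) (Mt Ms : nat)
    (Tb Wb : nat -> nat -> R) (Z sigma : nat -> nat -> R) : Prop := {
  fd_heat : let tau := D / INR Mt in let h := x_r / INR Ms in
    forall i k, (1 <= i <= Ms - 1)%nat -> (1 <= k <= Mt)%nat ->
    mid (Wb i) k + a * delta tau (Wb i) k
    = K * (delta2 h (fun j => mid (Tb j) k) i
           + b * delta2 h (fun j => mid (Wb j) k) i)
      + mid (fun l => F (INR i * h) (INR l * tau)) k;
  fd_init : let h := x_r / INR Ms in
    forall i, (i <= Ms)%nat ->
    Tb i 0%nat = xi1 (INR i * h) /\ Wb i 0%nat = eta1 (INR i * h);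
  fd_left : forall k, (1 <= k <= Mt)%nat -> mid (Tb 0%nat) k = 0;
  fd_right : let tau := D / INR Mt in let h := x_r / INR Ms in
    forall k, (1 <= k <= Mt)%nat ->
    mid (Wb Ms) k + a * delta tau (Wb Ms) k
    = 2 * K / h *
        (- delta h (fun j => mid (Tb j) k) Ms
         - b * delta h (fun j => mid (Wb j) k) Ms
         - sqrt (z0 / K) *
             ((1 + sum_ab N) * mid (Wb Ms) k
              - z0 * sum_n_m (fun n => coef_a N n / coef_b N n
                                    * mid (sigma n) k) 1 N)
         + mid (fun l => Q (INR l * tau)) k)
      + mid (fun l => F (INR Ms * h) (INR l * tau)) k;
  fd_zeta : let tau := D / INR Mt in
    forall n k, (1 <= n <= N)%nat -> (1 <= k <= Mt)%nat ->
    (z0 - coef_b N n * z0) * mid (sigma n) k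
    + coef_b N n *
        (mid (Z n) k + (a + b) * mid (sigma n) k
         + a * b * delta tau (sigma n) k)
    = mid (Wb Ms) k + mid (fun l => Rt (INR l * tau)) k;
  fd_zeta_init : forall n, (1 <= n <= N)%nat ->
    Z n 0%nat = 0 /\ sigma n 0%nat = 0;
  fd_W : let tau := D / INR Mt in let h := x_r / INR Ms in
    forall i k, (1 <= i <= Ms)%nat -> (1 <= k <= Mt)%nat ->
    delta h (fun j => mid (Wb j) k) i
    - delta h (fun j => delta tau (Tb j) k) i = 0;
  fd_sigma : let tau := D / INR Mt in
    forall n k, (1 <= n <= N)%nat -> (1 <= k <= Mt)%nat ->
    mid (sigma n) k - delta tau (Z n) k = 0;
  (* the standing convention that Tb^k and Wb^k lie in V = {v | v_0 = 0} *)
  fd_V : forall k, (k <= Mt)%nat -> Tb 0%nat k = 0 /\ Wb 0%nat k = 0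
}.

(* Main.v *)
Require Import Defs.
From Stdlib Require Import Reals Lra Lia Psatz List RList ClassicalEpsilon.
From Coquelicot Require Import Coquelicot.
Open Scope R_scope.

(** The scheme is linear, so the errors [e = T - Tb], [w = T_t - Wb],
    [r_n = zeta_n - Z_n], [s_n = zeta_n' - sigma_n] solve the homogeneous scheme
    up to truncation residuals, and the theorem is consistency ([*_consistent])
    combined with unconditional stability ([stability]).

    Stability is a discrete energy estimate.  The energy at level [k] is
    the sum of [h (a/2 w^2 + K/2 (delta_x e)^2)] over the grid, with half weight
    on the boundary value of [w], plus the energy
    [c a_n (r_n^2 + a b s_n^2) / 2] of the auxiliary variables,
    [c = K sqrt(z0/K) z0].  Testing the heat equation with the midpoint
    value of [w] and summing by parts leaves the dissipation
    [w^2 + K b (delta_x w)^2] and the boundary term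
    [- K sqrt(z0/K) ((1 + sum a_n/b_n) w^2 - z0 w sum (a_n/b_n) s_n)], whose cross
    terms have no sign.  Adding the equations of the [s_n] tested with
    [(a_n/b_n) s_n] doubles the cross terms and supplies squares of the [s_n].
    Because [a_n = kap (1 - b_n)] with [kap = 2/(2N+1)],
    the result is a sum of squares plus a remainder:
      [(1 + sum a_n/b_n) w^2 - 2 z0 w sum (a_n/b_n) s_n
         + z0^2 sum (a_n/b_n) (1 - b_n) s_n^2
       = w^2/(2N+1) + sum (kap/b_n) (w - (1 - b_n) z0 s_n)^2].
    So the absorbing boundary condition is dissipative.  The surviving
    [w^2/(2N+1)] also absorbs the boundary residual; hence that residual enters
    only after multiplication by [h], and it may be of first order in [h].

    Only the compatibility residuals [delta_x w - delta_x delta_t e] and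
    [s_n - delta_t r_n] are tested with quantities that are controlled by the
    energy and not by the dissipation.  Young's inequality with weight [1/D] gives
    [Q_k - Q_(k-1) <= (dt/D) ((Q_k + Q_(k-1))/2 + A)] with [A] proportional to the
    squared residual; as [dt <= D], the discrete Gronwall inequality
    ([crank_nicolson_gronwall]) applies to every step size.  A discrete Sobolev
    inequality ([grid_sobolev]) turns the energy bound into a maximum bound.

    Consistency is Taylor's formula.  The derivatives are one-sided at the
    ends of the intervals, so the formula is rebuilt from a mean value theorem on a
    closed interval; crude constants suffice.  The equations of the problem,
    given for [t > 0], are used at [t = 0] as well, by continuity. *)

(** * Derivatives relative to a closed interval *)

Definition deriv_on (lo hi : R) (f f' : R -> R) : Prop :=
  forall x, lo <= x <= hi -> is_derive_within lo hi f x (f' x).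

(** A limit point of the filter of neighbourhoods of [x] within the interval can
    only be [x] itself, so the filter-based notion reduces to one estimate at
    [x]. *)
Lemma is_derive_within_eps lo hi f x l (Hx : lo <= x <= hi) :
  is_derive_within lo hi f x l <->
  forall eps : posreal, exists d : posreal, forall y, lo <= y <= hi ->
    Rabs (y - x) < d ->
    Rabs (f y - f x - (y - x) * l) <= eps * Rabs (y - x).
Proof.
split.
- intros [_ H] eps.
  assert (L : is_filter_lim (within (fun y => lo <= y <= hi) (locally x)) x).
  { intros P HP; unfold within; revert HP; apply filter_imp; auto. }
  destruct (H x L eps) as [d Hd].
  exists d; intros y Hy Hyx; exact (Hd y Hyx Hy).
- intros H; split; [exact (is_linear_scal_l l)|].
  intros x' L eps.
  assert (E : x = x').
  { apply NNPP; intros Hne.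
    assert (Hp : 0 < Rabs (x' - x)) by (apply Rabs_pos_lt; lra).
    assert (B : within (fun y => lo <= y <= hi) (locally x)
                  (fun y => Rabs (y - x') < Rabs (x' - x) / 2)).
    { apply L; exists (mkposreal (Rabs (x' - x) / 2) ltac:(lra)).
      intros y Hy; exact Hy. }
    destruct B as [d Hd].
    assert (Hb : Rabs (x - x') < Rabs (x' - x) / 2).
    { apply Hd; [apply ball_center|exact Hx]. }
    rewrite Rabs_minus_sym in Hb; lra. }
  subst x'; destruct (H eps) as [d Hd]; exists d.
  intros y Hy Hin; exact (Hd y Hin Hy).
Qed.

Lemma is_derive_within_unique lo hi f x l l' (Hlt : lo < hi)
  (Hx : lo <= x <= hi) :
  is_derive_within lo hi f x l -> is_derive_within lo hi f x l' -> l = l'.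
Proof.
rewrite !(is_derive_within_eps _ _ _ _ _ Hx); intros H H'.
apply NNPP; intros Hne.
assert (Hp : 0 < Rabs (l - l')) by (apply Rabs_pos_lt; lra).
destruct (H (mkposreal (Rabs (l - l') / 4) ltac:(lra))) as [d Hd].
destruct (H' (mkposreal (Rabs (l - l') / 4) ltac:(lra))) as [d' Hd'].
simpl in Hd, Hd'.
assert (Hy : exists y, lo <= y <= hi /\ 0 < Rabs (y - x) /\
             Rabs (y - x) < d /\ Rabs (y - x) < d').
{ pose proof (cond_pos d); pose proof (cond_pos d').
  destruct (Rlt_le_dec x hi) as [Hxh|Hxh].
  - set (r := Rmin (hi - x) (Rmin (d / 2) (d' / 2))).
    assert (0 < r) by (unfold r; repeat apply Rmin_glb_lt; lra).
    assert (r <= hi - x) by apply Rmin_l.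
    assert (r <= Rmin (d / 2) (d' / 2)) by apply Rmin_r.
    pose proof (Rmin_l (d / 2) (d' / 2)); pose proof (Rmin_r (d / 2) (d' / 2)).
    exists (x + r); replace (x + r - x) with r by ring.
    rewrite (Rabs_pos_eq r) by lra; lra.
  - set (r := Rmin (x - lo) (Rmin (d / 2) (d' / 2))).
    assert (0 < r) by (unfold r; repeat apply Rmin_glb_lt; lra).
    assert (r <= x - lo) by apply Rmin_l.
    assert (r <= Rmin (d / 2) (d' / 2)) by apply Rmin_r.
    pose proof (Rmin_l (d / 2) (d' / 2)); pose proof (Rmin_r (d / 2) (d' / 2)).
    exists (x - r); replace (x - r - x) with (- r) by ring.
    rewrite Rabs_Ropp, (Rabs_pos_eq r) by lra; lra. }
destruct Hy as (y & Hy & Hy0 & Hyd & Hyd').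
specialize (Hd y Hy Hyd); specialize (Hd' y Hy Hyd').
assert (Ht : Rabs ((y - x) * (l - l')) <= Rabs (l - l') / 2 * Rabs (y - x)).
{ replace ((y - x) * (l - l'))
    with ((f y - f x - (y - x) * l') - (f y - f x - (y - x) * l)) by ring.
  eapply Rle_trans; [apply Rabs_triang|]; rewrite Rabs_Ropp; lra. }
rewrite Rabs_mult in Ht; nra.
Qed.

Lemma Derive_within_unique lo hi f x l (Hlt : lo < hi) (Hx : lo <= x <= hi) :
  is_derive_within lo hi f x l -> Derive_within lo hi f x = l.
Proof.
intros H; apply (is_derive_within_unique lo hi f x); auto.
apply (@iota_correct R_AbsRing R_CompleteNormedModule (is_derive_within lo hi f x)).
exists l; split; auto.
intros l' H'; apply (is_derive_within_unique lo hi f x); auto.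
Qed.

Lemma Derive_within_correct lo hi f x (Hlt : lo < hi) (Hx : lo <= x <= hi) :
  ex_derive_within lo hi f x ->
  is_derive_within lo hi f x (Derive_within lo hi f x).
Proof.
intros [l H]; rewrite (Derive_within_unique _ _ _ _ l); auto.
Qed.

Lemma deriv_on_minus lo hi f f' p p' :
  deriv_on lo hi f f' -> deriv_on lo hi p p' ->
  deriv_on lo hi (fun y => f y - p y) (fun y => f' y - p' y).
Proof.
intros Hf Hp x Hx; specialize (Hf x Hx); specialize (Hp x Hx).
rewrite is_derive_within_eps in Hf, Hp by assumption.
rewrite is_derive_within_eps by assumption.
intros eps; destruct (Hf (pos_div_2 eps)) as [d1 H1].
destruct (Hp (pos_div_2 eps)) as [d2 H2].
exists (mkposreal (Rmin d1 d2) (Rmin_stable_in_posreal d1 d2)); simpl.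
intros y Hy Hyx.
pose proof (Rmin_l d1 d2); pose proof (Rmin_r d1 d2).
specialize (H1 y Hy ltac:(lra)); specialize (H2 y Hy ltac:(lra)).
simpl in H1, H2.
replace (f y - p y - (f x - p x) - (y - x) * (f' x - p' x))
  with ((f y - f x - (y - x) * f' x) - (p y - p x - (y - x) * p' x)) by ring.
eapply Rle_trans; [apply Rabs_triang|]; rewrite Rabs_Ropp; lra.
Qed.

Lemma deriv_on_of_is_derive lo hi p p' :
  (forall x, is_derive p x (p' x)) -> deriv_on lo hi p p'.
Proof.
intros H x Hx; apply is_derive_within_eps; [assumption|].
intros eps; destruct (H x) as [_ Hd].
destruct (Hd x (fun P HP => HP) eps) as [d Hd'].
exists d; intros y _ Hy; exact (Hd' y Hy).
Qed.

(** Composing [f] with the projection [clamp] onto the interval makes it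
    continuous on the whole line without changing it inside, so that the
    two-sided mean value theorem applies even at the endpoints. *)
Lemma deriv_on_MVT lo hi f f' x y :
  deriv_on lo hi f f' -> lo <= x <= hi -> lo <= y <= hi ->
  exists c, Rmin x y <= c <= Rmax x y /\ f y - f x = f' c * (y - x).
Proof.
intros Hf Hx Hy.
set (clamp z := Rmax lo (Rmin hi z)).
assert (Hcl : forall z, lo <= clamp z <= hi).
{ intros z; unfold clamp, Rmax, Rmin.
  destruct (Rle_dec hi z); destruct Rle_dec; lra. }
assert (Hid : forall z, lo <= z <= hi -> clamp z = z).
{ intros z Hz; unfold clamp, Rmax, Rmin.
  destruct (Rle_dec hi z); destruct Rle_dec; lra. }
assert (Hlip : forall z z', lo <= z' <= hi -> Rabs (clamp z - z') <= Rabs (z - z')).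
{ intros z z' Hz'; unfold clamp, Rmin; destruct (Rle_dec hi z);
  unfold Rmax; destruct Rle_dec; unfold Rabs;
  repeat destruct Rcase_abs; lra. }
set (g z := f (clamp z)).
assert (Hlo : lo <= Rmin x y) by (apply Rmin_glb; lra).
assert (Hhi : Rmax x y <= hi) by (apply Rmax_lub; lra).
destruct (MVT_gen g x y f') as (c & Hc & E).
- intros z Hz; split; [exact (is_linear_scal_l _)|].
  intros z' Hz' eps.
  assert (z = z') by exact (is_filter_lim_locally_unique _ _ Hz'); subst z'.
  assert (Hz2 : lo <= z <= hi) by lra.
  destruct (proj1 (is_derive_within_eps _ _ _ _ _ Hz2) (Hf z Hz2) eps) as [d Hd].
  assert (Hr : 0 < Rmin d (Rmin (z - lo) (hi - z))).
  { repeat apply Rmin_glb_lt; [apply cond_pos|lra|lra]. }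
  exists (mkposreal _ Hr); intros u Hu.
  change (Rabs (u - z) < Rmin d (Rmin (z - lo) (hi - z))) in Hu.
  pose proof (Rmin_l d (Rmin (z - lo) (hi - z))).
  pose proof (Rmin_r d (Rmin (z - lo) (hi - z))).
  pose proof (Rmin_l (z - lo) (hi - z)); pose proof (Rmin_r (z - lo) (hi - z)).
  assert (lo <= u <= hi).
  { assert (Hu' : Rabs (u - z) < z - lo /\ Rabs (u - z) < hi - z) by lra.
    destruct Hu' as [Hu1 Hu2].
    apply Rabs_def2 in Hu1; apply Rabs_def2 in Hu2; lra. }
  change (Rabs (g u - g z - (u - z) * f' z) <= eps * Rabs (u - z)).
  unfold g; rewrite !Hid by assumption; apply Hd; [assumption|lra].
- intros z Hz; assert (Hz2 : lo <= z <= hi) by lra.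
  destruct (proj1 (is_derive_within_eps _ _ _ _ _ Hz2) (Hf z Hz2)
              (mkposreal 1 Rlt_0_1)) as [d Hd]; simpl in Hd.
  intros eps Heps.
  set (L := Rabs (f' z) + 1).
  assert (HL : 0 < L) by (unfold L; pose proof (Rabs_pos (f' z)); lra).
  assert (Hr : 0 < Rmin d (eps / L)).
  { apply Rmin_glb_lt; [apply cond_pos|apply Rdiv_lt_0_compat; lra]. }
  exists (Rmin d (eps / L)); split; [exact Hr|].
  intros u [_ Hu]; simpl in Hu |- *; unfold Rdist in *.
  pose proof (Rmin_l d (eps / L)); pose proof (Rmin_r d (eps / L)).
  unfold g; rewrite (Hid z) by assumption.
  pose proof (Hlip u z Hz2) as Hl.
  specialize (Hd (clamp u) (Hcl u) ltac:(lra)).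
  apply Rle_lt_trans with (L * Rabs (clamp u - z)).
  { replace (f (clamp u) - f z)
      with ((f (clamp u) - f z - (clamp u - z) * f' z) + (clamp u - z) * f' z)
      by ring.
    eapply Rle_trans; [apply Rabs_triang|].
    rewrite (Rabs_mult (clamp u - z)); unfold L; lra. }
  apply Rle_lt_trans with (L * Rabs (u - z)); [nra|].
  apply Rlt_le_trans with (L * (eps / L)); [nra|].
  right; field; lra.
- exists c; split; [exact Hc|].
  unfold g in E; rewrite !Hid in E by assumption; exact E.
Qed.

(** One step of Taylor's formula: a Taylor remainder vanishes at the centre and its
    derivative is the remainder of the derivative, one order lower.  The mean value
    theorem loses the factor [1/(n+1)], which is harmless here. *)
Lemma vanishing_bound lo hi g g' x M n :
  deriv_on lo hi g g' -> lo <= x <= hi -> g x = 0 -> 0 <= M ->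
  (forall y, lo <= y <= hi -> Rabs (g' y) <= M * Rabs (y - x) ^ n) ->
  forall y, lo <= y <= hi -> Rabs (g y) <= M * Rabs (y - x) ^ S n.
Proof.
intros Hg Hx Hgx HM Hb y Hy.
destruct (deriv_on_MVT lo hi g g' x y Hg Hx Hy) as (c & Hc & E).
rewrite Hgx, Rminus_0_r in E; rewrite E, Rabs_mult.
assert (Hcx : lo <= c <= hi /\ Rabs (c - x) <= Rabs (y - x)).
{ unfold Rmin, Rmax in Hc; destruct (Rle_dec x y).
  - rewrite !Rabs_pos_eq by lra; lra.
  - rewrite !Rabs_left1 by lra; lra. }
destruct Hcx as [Hc' Hcx]; simpl.
rewrite (Rmult_comm (Rabs (y - x))), <- Rmult_assoc.
apply Rmult_le_compat_r; [apply Rabs_pos|].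
eapply Rle_trans; [apply Hb; assumption|].
apply Rmult_le_compat_l; [assumption|].
apply pow_incr; split; [apply Rabs_pos|assumption].
Qed.

Section Taylor.
Variables (lo hi M x : R).
Hypotheses (Hx : lo <= x <= hi) (HM : 0 <= M).

Lemma taylor0 f f1 :
  deriv_on lo hi f f1 -> (forall y, lo <= y <= hi -> Rabs (f1 y) <= M) ->
  forall y, lo <= y <= hi -> Rabs (f y - f x) <= M * Rabs (y - x) ^ 1.
Proof.
intros H Hb; apply (vanishing_bound lo hi (fun y => f y - f x) (fun y => f1 y - 0) x M 0);
  auto; try ring.
- apply (deriv_on_minus lo hi f f1 (fun _ => f x) (fun _ => 0)); auto.
  apply deriv_on_of_is_derive; intros z; auto_derive; auto.
- intros y Hy; rewrite Rminus_0_r, pow_O, Rmult_1_r; auto.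
Qed.

Lemma taylor1 f f1 f2 :
  deriv_on lo hi f f1 -> deriv_on lo hi f1 f2 ->
  (forall y, lo <= y <= hi -> Rabs (f2 y) <= M) ->
  forall y, lo <= y <= hi ->
  Rabs (f y - (f x + f1 x * (y - x))) <= M * Rabs (y - x) ^ 2.
Proof.
intros H H1 Hb.
apply (vanishing_bound lo hi (fun y => f y - (f x + f1 x * (y - x)))
         (fun y => f1 y - f1 x) x M 1); auto; try ring.
- apply (deriv_on_minus lo hi f f1 (fun y => f x + f1 x * (y - x)) (fun _ => f1 x)); auto.
  apply deriv_on_of_is_derive; intros z; auto_derive; [auto|ring].
- apply (taylor0 f1 f2); auto.
Qed.

Lemma taylor2 f f1 f2 f3 :
  deriv_on lo hi f f1 -> deriv_on lo hi f1 f2 -> deriv_on lo hi f2 f3 ->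
  (forall y, lo <= y <= hi -> Rabs (f3 y) <= M) ->
  forall y, lo <= y <= hi ->
  Rabs (f y - (f x + f1 x * (y - x) + f2 x * (y - x) ^ 2 / 2))
  <= M * Rabs (y - x) ^ 3.
Proof.
intros H H1 H2 Hb.
apply (vanishing_bound lo hi
         (fun y => f y - (f x + f1 x * (y - x) + f2 x * (y - x) ^ 2 / 2))
         (fun y => f1 y - (f1 x + f2 x * (y - x))) x M 2); auto; try field.
- apply (deriv_on_minus lo hi f f1
           (fun y => f x + f1 x * (y - x) + f2 x * (y - x) ^ 2 / 2)); auto.
  apply deriv_on_of_is_derive; intros z; auto_derive; [auto|field].
- apply (taylor1 f1 f2 f3); auto.
Qed.

Lemma taylor3 f f1 f2 f3 f4 :
  deriv_on lo hi f f1 -> deriv_on lo hi f1 f2 -> deriv_on lo hi f2 f3 ->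
  deriv_on lo hi f3 f4 ->
  (forall y, lo <= y <= hi -> Rabs (f4 y) <= M) ->
  forall y, lo <= y <= hi ->
  Rabs (f y - (f x + f1 x * (y - x) + f2 x * (y - x) ^ 2 / 2
               + f3 x * (y - x) ^ 3 / 6))
  <= M * Rabs (y - x) ^ 4.
Proof.
intros H H1 H2 H3 Hb.
apply (vanishing_bound lo hi
         (fun y => f y - (f x + f1 x * (y - x) + f2 x * (y - x) ^ 2 / 2
                          + f3 x * (y - x) ^ 3 / 6))
         (fun y => f1 y - (f1 x + f2 x * (y - x) + f3 x * (y - x) ^ 2 / 2)) x M 3);
  auto; try field.
- apply (deriv_on_minus lo hi f f1
           (fun y => f x + f1 x * (y - x) + f2 x * (y - x) ^ 2 / 2
                     + f3 x * (y - x) ^ 3 / 6)); auto.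
  apply deriv_on_of_is_derive; intros z; auto_derive; [auto|field].
- apply (taylor2 f1 f2 f3 f4); auto.
Qed.
End Taylor.

(** * Finite sums *)

Lemma sum_add (u v : nat -> R) n m :
  sum_n_m (fun k => u k + v k) n m = sum_n_m u n m + sum_n_m v n m.
Proof. exact (sum_n_m_plus u v n m). Qed.

Lemma sum_scal (c : R) (u : nat -> R) n m :
  sum_n_m (fun k => c * u k) n m = c * sum_n_m u n m.
Proof. exact (sum_n_m_mult_l (c : R_Ring) u n m). Qed.

Lemma sum_ext (u v : nat -> R) n m :
  (forall k, (n <= k <= m)%nat -> u k = v k) -> sum_n_m u n m = sum_n_m v n m.
Proof. exact (sum_n_m_ext_loc u v n m). Qed.

Lemma sum_sub (u v : nat -> R) n m :
  sum_n_m (fun k => u k - v k) n m = sum_n_m u n m - sum_n_m v n m.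
Proof.
replace (sum_n_m u n m - sum_n_m v n m)
  with (sum_n_m u n m + -1 * sum_n_m v n m) by ring.
rewrite <- sum_scal, <- sum_add; apply sum_ext; intros k _; ring.
Qed.

Lemma sum_S (u : nat -> R) m :
  sum_n_m u 1 (S m) = sum_n_m u 1 m + u (S m).
Proof. exact (sum_n_Sm u 1 m ltac:(lia)). Qed.

Lemma sum_1_0 (u : nat -> R) : sum_n_m u 1 0 = 0.
Proof. exact (sum_n_m_zero u 1 0 ltac:(lia)). Qed.

Lemma sum_le_loc (u v : nat -> R) m :
  (forall k, (1 <= k <= m)%nat -> u k <= v k) -> sum_n_m u 1 m <= sum_n_m v 1 m.
Proof.
induction m as [|m IH]; intros H; [rewrite !sum_1_0; lra|].
rewrite !sum_S; apply Rplus_le_compat; [apply IH; intros|]; apply H; lia.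
Qed.

Lemma sum_nonneg (u : nat -> R) m :
  (forall k, (1 <= k <= m)%nat -> 0 <= u k) -> 0 <= sum_n_m u 1 m.
Proof.
intros H; replace 0 with (sum_n_m (fun _ => 0) 1 m) by (rewrite sum_n_m_const; apply Rmult_0_r).
apply sum_le_loc; exact H.
Qed.

Lemma sum_telescope_le (u v J : nat -> R) m :
  (forall k, (1 <= k <= m)%nat -> u k <= J k - J (k - 1)%nat + v k) ->
  sum_n_m u 1 m <= J m - J 0%nat + sum_n_m v 1 m.
Proof.
induction m as [|m IH]; intros H; [rewrite !sum_1_0; lra|].
rewrite !sum_S.
assert (H1 := H (S m) ltac:(lia)); replace (S m - 1)%nat with m in H1 by lia.
assert (H2 := IH ltac:(intros; apply H; lia)); lra.
Qed.

(** The Cauchy-Schwarz inequality against the constant sequence. *)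
Lemma sum_sqr_le (d : nat -> R) m :
  (sum_n_m d 1 m) ^ 2 <= INR m * sum_n_m (fun k => d k ^ 2) 1 m.
Proof.
assert (X : forall c m, 2 * sum_n_m d 1 m * c
              <= sum_n_m (fun k => d k ^ 2) 1 m + INR m * c ^ 2).
{ intros c n; induction n as [|n IH]; [rewrite !sum_1_0; simpl; lra|].
  rewrite !sum_S, S_INR; pose proof (pow2_ge_0 (d (S n) - c)); nra. }
induction m as [|m IH]; [rewrite !sum_1_0; simpl; lra|].
rewrite !sum_S, S_INR; specialize (X (d (S m)) m); nra.
Qed.

Lemma sqr_bound (x e : R) : Rabs x <= e -> x ^ 2 <= e ^ 2.
Proof. intros H; rewrite <- (pow2_abs x); apply pow_incr; split; auto; apply Rabs_pos. Qed.

(** * Continuity and boundedness on intervals and rectangles *)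

Lemma continuous_on_lincomb {U : UniformSpace} (P : U -> Prop) (f g : U -> R) (c : R) :
  continuous_on P f -> continuous_on P g ->
  continuous_on P (fun x => f x + c * g x).
Proof.
intros Hf Hg x Hx.
eapply filterlim_comp_2; [exact (Hf x Hx)| |exact (filterlim_plus (f x) (c * g x))].
eapply filterlim_comp; [exact (Hg x Hx)|exact (filterlim_scal_r c (g x))].
Qed.

Lemma continuous_on_sum {U : UniformSpace} (P : U -> Prop) (c : nat -> R)
  (g : nat -> U -> R) N :
  (forall n, (1 <= n <= N)%nat -> continuous_on P (g n)) ->
  continuous_on P (fun x => sum_n_m (fun n => c n * g n x) 1 N).
Proof.
induction N as [|N IH]; intros H.
- apply continuous_on_ext with (fun _ => 0).
  + intros x _; symmetry; apply sum_1_0.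
  + intros x _; apply filterlim_const.
- apply continuous_on_ext with
    (fun x => sum_n_m (fun n => c n * g n x) 1 N + c (S N) * g (S N) x).
  + intros x _; symmetry; apply (sum_S (fun n => c n * g n x)).
  + apply continuous_on_lincomb; [apply IH; intros; apply H; lia|apply H; lia].
Qed.

Lemma continuous_on_slice (P : R * R -> Prop) (I : R -> Prop) (g : R * R -> R) x :
  continuous_on P g -> (forall t, I t -> P (x, t)) ->
  continuous_on I (fun t => g (x, t)).
Proof.
intros Hg HI t Ht.
eapply filterlim_comp; [|exact (Hg (x, t) (HI t Ht))].
intros Q [d Hd]; exists d; intros s Hs Hs'.
apply Hd; [split; [apply ball_center|exact Hs]|apply HI; exact Hs'].
Qed.

Lemma zero_at_left_end D g : 0 < D ->
  continuous_on (fun t => 0 <= t <= D) g ->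
  (forall t, 0 < t <= D -> g t = 0) -> forall t, 0 <= t <= D -> g t = 0.
Proof.
intros HD Hg H0 t Ht.
destruct (Rle_lt_or_eq_dec 0 t (proj1 Ht)) as [Hp|<-]; [apply H0; lra|].
apply NNPP; intros Hne.
assert (Hp : 0 < Rabs (g 0)) by (apply Rabs_pos_lt; exact Hne).
assert (B := proj1 (filterlim_locally g (g 0)) (Hg 0 Ht) (mkposreal _ Hp)).
destruct B as [d Hd].
assert (Hr : 0 < Rmin (d / 2) D).
{ apply Rmin_glb_lt; [pose proof (cond_pos d)|]; lra. }
pose proof (Rmin_l (d / 2) D); pose proof (Rmin_r (d / 2) D).
pose proof (cond_pos d).
assert (X : Rabs (g (Rmin (d / 2) D) - g 0) < Rabs (g 0)).
{ apply (Hd (Rmin (d / 2) D)); [|lra].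
  change (Rabs (Rmin (d / 2) D - 0) < d).
  rewrite Rminus_0_r, Rabs_pos_eq; lra. }
rewrite H0 in X by lra.
rewrite Rminus_0_l, Rabs_Ropp in X; lra.
Qed.

(** The gauge [delta] is chosen both as a modulus of continuity and below
    [1/(1 + |u|)].  Compactness gives a uniform lower bound [d] for the gauge near
    every point; there [|u|] is at most [1/d], up to the oscillation 1. *)
Lemma rectangle_bounded x0 x1 t0 t1 (u : R -> R -> R) :
  (forall x t, x0 <= x <= x1 -> t0 <= t <= t1 ->
     exists d : posreal, forall y s, x0 <= y <= x1 -> t0 <= s <= t1 ->
       Rabs (y - x) < d -> Rabs (s - t) < d -> Rabs (u y s - u x t) < 1) ->
  exists M, 0 <= M /\
    forall x t, x0 <= x <= x1 -> t0 <= t <= t1 -> Rabs (u x t) <= M.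
Proof.
intros Hu.
assert (X : forall p : R * R, exists d : posreal,
  d <= / (1 + Rabs (u (fst p) (snd p))) /\
  (x0 <= fst p <= x1 -> t0 <= snd p <= t1 ->
   forall y s, x0 <= y <= x1 -> t0 <= s <= t1 ->
     Rabs (y - fst p) < d -> Rabs (s - snd p) < d ->
     Rabs (u y s - u (fst p) (snd p)) < 1)).
{ intros [x t]; simpl.
  assert (Hp : 0 < / (1 + Rabs (u x t))).
  { apply Rinv_0_lt_compat; pose proof (Rabs_pos (u x t)); lra. }
  destruct (classic (x0 <= x <= x1 /\ t0 <= t <= t1)) as [[Hx Ht]|Hn].
  - destruct (Hu x t Hx Ht) as [d Hd].
    exists (mkposreal _ (Rmin_pos _ _ (cond_pos d) Hp)); simpl; split; [apply Rmin_r|].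
    intros _ _ y s Hy Hs H1 H2.
    pose proof (Rmin_l d (/ (1 + Rabs (u x t)))); apply Hd; auto; lra.
  - exists (mkposreal _ Hp); simpl; split; [lra|intros; tauto]. }
pose (delta := fun x t => proj1_sig (constructive_indefinite_description _ (X (x, t)))).
assert (Hdelta : forall x t, delta x t <= / (1 + Rabs (u x t)) /\
  (x0 <= x <= x1 -> t0 <= t <= t1 ->
   forall y s, x0 <= y <= x1 -> t0 <= s <= t1 ->
     Rabs (y - x) < delta x t -> Rabs (s - t) < delta x t ->
     Rabs (u y s - u x t) < 1)).
{ intros x t; exact (proj2_sig (constructive_indefinite_description _ (X (x, t)))). }
clearbody delta.
destruct (compactness_value_2d x0 x1 t0 t1 delta) as [d Hd].
exists (/ d + 1); split.
{ assert (0 < / d) by (apply Rinv_0_lt_compat, cond_pos); lra. }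
intros x t Hx Ht.
apply NNPP; intros Hn; apply (Hd x t Hx Ht); intros (y & s & Hy & Hs & H1 & H2 & H3).
apply Hn; destruct (Hdelta y s) as [E1 E2].
assert (Hyp : 0 < 1 + Rabs (u y s)) by (pose proof (Rabs_pos (u y s)); lra).
assert (E3 : 1 + Rabs (u y s) <= / d).
{ rewrite <- (Rinv_inv (1 + Rabs (u y s))).
  apply Rinv_le_contravar; [apply cond_pos|lra]. }
specialize (E2 Hy Hs x t Hx Ht H1 H2).
pose proof (Rabs_triang (u x t - u y s) (u y s)) as Htr.
replace (u x t - u y s + u y s) with (u x t) in Htr by ring; lra.
Qed.

Lemma C_interval_bounded n lo hi f : C_interval n lo hi f ->
  exists M, 0 <= M /\ forall x, lo <= x <= hi -> Rabs (f x) <= M.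
Proof.
intros H; assert (Hc : continuous_on (fun x => lo <= x <= hi) f)
  by (destruct n; exact (proj1 H)).
destruct (rectangle_bounded lo hi 0 0 (fun x _ => f x)) as (M & HM & Hb).
- intros x t Hx _.
  destruct (proj1 (filterlim_locally f (f x)) (Hc x Hx) (mkposreal 1 Rlt_0_1)) as [d Hd].
  exists d; intros y s Hy _ Hyx _; exact (Hd y Hyx Hy).
- exists M; split; auto; intros x Hx; apply (Hb x 0 Hx); lra.
Qed.

Lemma C_rectangle_bounded n x_r D u : C_rectangle n x_r D u ->
  exists M, 0 <= M /\
    forall x t, 0 <= x <= x_r -> 0 <= t <= D -> Rabs (u x t) <= M.
Proof.
intros H; assert (Hc : continuous_on
  (fun p : R * R => 0 <= fst p <= x_r /\ 0 <= snd p <= D)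
  (fun p => u (fst p) (snd p))) by (destruct n; exact (proj1 H)).
apply rectangle_bounded; intros x t Hx Ht.
destruct (proj1 (filterlim_locally _ _) (Hc (x, t) (conj Hx Ht)) (mkposreal 1 Rlt_0_1))
  as [d Hd].
exists d; intros y s Hy Hs Hyx Hst.
exact (Hd (y, s) (conj Hyx Hst) (conj Hy Hs)).
Qed.

Lemma C_rectangle_continuous_t n x_r D u x : C_rectangle n x_r D u ->
  0 <= x <= x_r -> continuous_on (fun t => 0 <= t <= D) (u x).
Proof.
intros H Hx; assert (Hc : continuous_on
  (fun p : R * R => 0 <= fst p <= x_r /\ 0 <= snd p <= D)
  (fun p => u (fst p) (snd p))) by (destruct n; exact (proj1 H)).
exact (continuous_on_slice _ (fun t => 0 <= t <= D) _ x Hc (fun t Ht => conj Hx Ht)).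
Qed.

Lemma C_rectangle_S n x_r D : forall u, C_rectangle (S n) x_r D u -> C_rectangle n x_r D u.
Proof.
induction n as [|n IH]; intros u [H1 (H2 & H3 & H4)]; [split; auto|].
split; [exact H1|]; split; [exact H2|]; split; apply IH; assumption.
Qed.

Lemma C_rectangle_px n x_r D u :
  C_rectangle (S n) x_r D u -> C_rectangle n x_r D (partial_x x_r u).
Proof. intros (_ & _ & H & _); exact H. Qed.

Lemma C_rectangle_pt n x_r D u :
  C_rectangle (S n) x_r D u -> C_rectangle n x_r D (partial_t D u).
Proof. intros (_ & _ & _ & H); exact H. Qed.

(** * Residuals of the scheme *)

(** The [*_res] operators are the equations of the scheme without their data, so
    that they are linear in the grid functions. *)
Definition heat_res (a b K tau h : R) (T W : nat -> nat -> R) (i k : nat) : R :=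
  mid (W i) k + a * delta tau (W i) k
  - K * (delta2 h (fun j => mid (T j) k) i
         + b * delta2 h (fun j => mid (W j) k) i).

Definition right_res (a b K z0 tau h : R) (N Ms : nat)
    (T W sigma : nat -> nat -> R) (k : nat) : R :=
  mid (W Ms) k + a * delta tau (W Ms) k
  - 2 * K / h *
      (- delta h (fun j => mid (T j) k) Ms
       - b * delta h (fun j => mid (W j) k) Ms
       - sqrt (z0 / K) *
           ((1 + sum_ab N) * mid (W Ms) k
            - z0 * sum_n_m (fun n => coef_a N n / coef_b N n
                                  * mid (sigma n) k) 1 N)).

Definition zeta_res (a b z0 tau : R) (N Ms : nat)
    (W Z sigma : nat -> nat -> R) (n k : nat) : R :=
  (z0 - coef_b N n * z0) * mid (sigma n) k
  + coef_b N n * (mid (Z n) k + (a + b) * mid (sigma n) k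
                  + a * b * delta tau (sigma n) k)
  - mid (W Ms) k.

Definition compat_res (tau h : R) (T W : nat -> nat -> R) (i k : nat) : R :=
  delta h (fun j => mid (W j) k) i - delta h (fun j => delta tau (T j) k) i.

Definition sigma_res (tau : R) (Z sigma : nat -> nat -> R) (n k : nat) : R :=
  mid (sigma n) k - delta tau (Z n) k.

(** The scheme with vanishing data, solved up to [eps].  The factor [h] in
    [sr_right] reflects that the boundary equation is a balance over half a cell,
    divided by its length. *)
Record small_residuals (a b K z0 tau h eps : R) (N Mt Ms : nat)
    (e w r s : nat -> nat -> R) : Prop := {
  sr_heat : forall i k, (1 <= i <= Ms - 1)%nat -> (1 <= k <= Mt)%nat ->
    Rabs (heat_res a b K tau h e w i k) <= eps;
  sr_right : forall k, (1 <= k <= Mt)%nat ->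
    Rabs (h * right_res a b K z0 tau h N Ms e w s k) <= eps;
  sr_zeta : forall n k, (1 <= n <= N)%nat -> (1 <= k <= Mt)%nat ->
    Rabs (zeta_res a b z0 tau N Ms w r s n k) <= eps;
  sr_compat : forall i k, (1 <= i <= Ms)%nat -> (1 <= k <= Mt)%nat ->
    Rabs (compat_res tau h e w i k) <= eps;
  sr_sigma : forall n k, (1 <= n <= N)%nat -> (1 <= k <= Mt)%nat ->
    Rabs (sigma_res tau r s n k) <= eps;
  sr_init : forall i, (i <= Ms)%nat -> e i 0%nat = 0 /\ w i 0%nat = 0;
  sr_init_aux : forall n, (1 <= n <= N)%nat -> r n 0%nat = 0 /\ s n 0%nat = 0;
  sr_left : forall k, (k <= Mt)%nat -> e 0%nat k = 0 /\ w 0%nat k = 0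
}.

Arguments sr_heat {a b K z0 tau h eps N Mt Ms e w r s}.
Arguments sr_right {a b K z0 tau h eps N Mt Ms e w r s}.
Arguments sr_zeta {a b K z0 tau h eps N Mt Ms e w r s}.
Arguments sr_compat {a b K z0 tau h eps N Mt Ms e w r s}.
Arguments sr_sigma {a b K z0 tau h eps N Mt Ms e w r s}.
Arguments sr_init {a b K z0 tau h eps N Mt Ms e w r s}.
Arguments sr_init_aux {a b K z0 tau h eps N Mt Ms e w r s}.
Arguments sr_left {a b K z0 tau h eps N Mt Ms e w r s}.

(** * Truncation errors *)

Section Truncation.
Variables (x_r D : R).
Hypotheses (Hxr : 0 < x_r) (HD : 0 < D).

Lemma C_rectangle_dx n u t : C_rectangle (S n) x_r D u -> 0 <= t <= D ->
  deriv_on 0 x_r (fun y => u y t) (fun y => partial_x x_r u y t).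
Proof.
intros [_ (H & _)] Ht y Hy; apply Derive_within_correct; auto.
apply (H y t Hy Ht).
Qed.

Lemma C_rectangle_dt n u x : C_rectangle (S n) x_r D u -> 0 <= x <= x_r ->
  deriv_on 0 D (fun s => u x s) (fun s => partial_t D u x s).
Proof.
intros [_ (H & _)] Hx s Hs; apply Derive_within_correct; auto.
apply (H x s Hx Hs).
Qed.

Lemma grid_point L M k : 0 < L -> (1 <= M)%nat -> (k <= M)%nat ->
  0 <= INR k * (L / INR M) <= L.
Proof.
intros HL HM Hk.
assert (0 < INR M) by (apply lt_0_INR; lia).
apply le_INR in Hk; pose proof (pos_INR k).
assert (0 < L / INR M) by (apply Rdiv_lt_0_compat; lra).
split; [apply Rmult_le_pos; lra|].
apply Rle_trans with (INR M * (L / INR M)); [apply Rmult_le_compat_r; lra|].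
right; field; lra.
Qed.

Lemma grid_pred k h : (1 <= k)%nat -> INR (k - 1) * h = INR k * h - h.
Proof. intros Hk; rewrite minus_INR by lia; simpl; ring. Qed.

Lemma trapezoid_defect f f1 f2 f3 M Mt k :
  deriv_on 0 D f f1 -> deriv_on 0 D f1 f2 -> deriv_on 0 D f2 f3 ->
  0 <= M -> (forall t, 0 <= t <= D -> Rabs (f3 t) <= M) ->
  (1 <= Mt)%nat -> (1 <= k <= Mt)%nat ->
  let tau := D / INR Mt in
  Rabs (mid (fun l => f1 (INR l * tau)) k - delta tau (fun l => f (INR l * tau)) k)
  <= 2 * M * tau ^ 2.
Proof.
intros H1 H2 H3 HM Hb HMt Hk tau.
assert (Htau : 0 < tau) by (apply Rdiv_lt_0_compat; [lra|apply lt_0_INR; lia]).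
assert (Ht := grid_point D Mt k HD HMt (proj2 Hk)).
assert (Hs := grid_point D Mt (k - 1) HD HMt ltac:(lia)).
fold tau in Ht, Hs; rewrite grid_pred in Hs by lia.
assert (A := taylor2 0 D M _ Hs HM f f1 f2 f3 H1 H2 H3 Hb _ Ht).
assert (B := taylor1 0 D M _ Hs HM f1 f2 f3 H2 H3 Hb _ Ht).
unfold mid, delta; rewrite grid_pred by lia.
set (t := INR k * tau) in *; set (s := t - tau) in *.
replace (t - s) with tau in A, B by (unfold s; ring).
rewrite (Rabs_pos_eq tau) in A, B by lra.
set (RA := f t - _) in A; set (RB := f1 t - _) in B.
replace ((f1 t + f1 s) / 2 - (f t - f s) / tau) with (RB / 2 - / tau * RA)
  by (unfold RA, RB; field; lra).
assert (A' : Rabs (/ tau * RA) <= M * tau ^ 2).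
{ rewrite Rabs_mult, Rabs_pos_eq by (left; apply Rinv_0_lt_compat; lra).
  apply (Rmult_le_reg_l tau); [lra|].
  rewrite <- Rmult_assoc, Rinv_r, Rmult_1_l by lra.
  eapply Rle_trans; [apply A|right; ring]. }
assert (B' : Rabs (RB / 2) <= M * tau ^ 2).
{ unfold Rdiv; rewrite Rabs_mult, (Rabs_pos_eq (/ 2)) by lra.
  pose proof (Rabs_pos RB); lra. }
unfold Rminus; eapply Rle_trans; [apply Rabs_triang|]; rewrite Rabs_Ropp; lra.
Qed.

Lemma central_difference_defect f f1 f2 f3 f4 M Ms i :
  deriv_on 0 x_r f f1 -> deriv_on 0 x_r f1 f2 -> deriv_on 0 x_r f2 f3 ->
  deriv_on 0 x_r f3 f4 ->
  0 <= M -> (forall x, 0 <= x <= x_r -> Rabs (f4 x) <= M) ->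
  (1 <= i <= Ms - 1)%nat ->
  let h := x_r / INR Ms in
  Rabs (delta2 h (fun j => f (INR j * h)) i - f2 (INR i * h)) <= 2 * M * h ^ 2.
Proof.
intros H1 H2 H3 H4 HM Hb Hi h.
assert (Hh : 0 < h) by (apply Rdiv_lt_0_compat; [lra|apply lt_0_INR; lia]).
assert (Hx := grid_point x_r Ms i Hxr ltac:(lia) ltac:(lia)).
assert (Hx1 := grid_point x_r Ms (S i) Hxr ltac:(lia) ltac:(lia)).
assert (Hx0 := grid_point x_r Ms (i - 1) Hxr ltac:(lia) ltac:(lia)).
fold h in Hx, Hx1, Hx0; rewrite grid_pred in Hx0 by lia; rewrite S_INR in Hx1.
assert (A := taylor3 0 x_r M _ Hx HM f f1 f2 f3 f4 H1 H2 H3 H4 Hb _ Hx1).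
assert (B := taylor3 0 x_r M _ Hx HM f f1 f2 f3 f4 H1 H2 H3 H4 Hb _ Hx0).
unfold delta2, delta.
replace (S i - 1)%nat with i by lia; rewrite S_INR, grid_pred by lia.
set (x := INR i * h) in *.
replace ((INR i + 1) * h) with (x + h) in * by (unfold x; ring).
replace (x + h - x) with h in A by ring; replace (x - h - x) with (- h) in B by ring.
rewrite Rabs_Ropp in B; rewrite (Rabs_pos_eq h) in A, B by lra.
set (RA := f (x + h) - _) in A; set (RB := f (x - h) - _) in B.
replace (((f (x + h) - f x) / h - (f x - f (x - h)) / h) / h - f2 x)
  with (/ h ^ 2 * (RA + RB)) by (unfold RA, RB; field; lra).
assert (Hh2 : 0 < h ^ 2) by (apply pow_lt; lra).
rewrite Rabs_mult, Rabs_pos_eq by (left; apply Rinv_0_lt_compat; lra).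
apply (Rmult_le_reg_l (h ^ 2)); [lra|].
rewrite <- Rmult_assoc, Rinv_r, Rmult_1_l by lra.
eapply Rle_trans; [apply Rabs_triang|].
apply Rle_trans with (M * h ^ 4 + M * h ^ 4); [lra|right; ring].
Qed.

(** The third-order Taylor remainder is divided by [h^2/2], and the cubic term has no
    counterpart on the other side of the boundary to cancel it: hence order one. *)
Lemma boundary_defect f f1 f2 f3 M Ms :
  deriv_on 0 x_r f f1 -> deriv_on 0 x_r f1 f2 -> deriv_on 0 x_r f2 f3 ->
  0 <= M -> (forall x, 0 <= x <= x_r -> Rabs (f3 x) <= M) ->
  (1 <= Ms)%nat ->
  let h := x_r / INR Ms in
  Rabs (2 / h * (f1 x_r - delta h (fun j => f (INR j * h)) Ms) - f2 x_r)
  <= 2 * M * h.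
Proof.
intros H1 H2 H3 HM Hb HMs h.
assert (HM' : 0 < INR Ms) by (apply lt_0_INR; lia).
assert (Hh : 0 < h) by (apply Rdiv_lt_0_compat; lra).
assert (HE : INR Ms * h = x_r) by (unfold h; field; lra).
assert (Hx0 := grid_point x_r Ms (Ms - 1) Hxr ltac:(lia) ltac:(lia)).
fold h in Hx0; rewrite grid_pred, HE in Hx0 by lia.
assert (A := taylor2 0 x_r M x_r ltac:(lra) HM f f1 f2 f3 H1 H2 H3 Hb _ Hx0).
unfold delta; rewrite grid_pred, HE by lia.
replace (x_r - h - x_r) with (- h) in A by ring.
rewrite Rabs_Ropp, (Rabs_pos_eq h) in A by lra.
set (RA := f (x_r - h) - _) in A.
replace (2 / h * (f1 x_r - (f x_r - f (x_r - h)) / h) - f2 x_r)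
  with (2 * / h ^ 2 * RA) by (unfold RA; field; lra).
assert (Hh2 : 0 < h ^ 2) by (apply pow_lt; lra).
assert (0 < / h ^ 2) by (apply Rinv_0_lt_compat; lra).
rewrite Rabs_mult, Rabs_pos_eq by lra.
apply (Rmult_le_reg_l (h ^ 2)); [lra|].
replace (h ^ 2 * (2 * / h ^ 2 * Rabs RA)) with (2 * Rabs RA) by (field; lra).
apply Rle_trans with (2 * (M * h ^ 3)); [lra|right; ring].
Qed.

Lemma central_difference_consistent u : C_rectangle 4 x_r D u ->
  exists M, 0 <= M /\ forall Ms i t, (1 <= i <= Ms - 1)%nat -> 0 <= t <= D ->
  let h := x_r / INR Ms in
  Rabs (delta2 h (fun j => u (INR j * h) t) i
        - partial_x x_r (partial_x x_r u) (INR i * h) t) <= M * h ^ 2.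
Proof.
intros H.
assert (Hx := C_rectangle_px _ _ _ _ H); assert (Hxx := C_rectangle_px _ _ _ _ Hx).
assert (Hxxx := C_rectangle_px _ _ _ _ Hxx); assert (Hx4 := C_rectangle_px _ _ _ _ Hxxx).
destruct (C_rectangle_bounded _ _ _ _ Hx4) as (M & HM & Hb).
exists (2 * M); split; [lra|].
intros Ms i t Hi Ht h.
exact (central_difference_defect _ _ _ _ _ M Ms i
  (C_rectangle_dx _ _ t H Ht) (C_rectangle_dx _ _ t Hx Ht)
  (C_rectangle_dx _ _ t Hxx Ht) (C_rectangle_dx _ _ t Hxxx Ht)
  HM (fun x Hx => Hb x t Hx Ht) Hi).
Qed.

Lemma boundary_consistent u : C_rectangle 3 x_r D u ->
  exists M, 0 <= M /\ forall Ms t, (1 <= Ms)%nat -> 0 <= t <= D ->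
  let h := x_r / INR Ms in
  Rabs (2 / h * (partial_x x_r u x_r t - delta h (fun j => u (INR j * h) t) Ms)
        - partial_x x_r (partial_x x_r u) x_r t) <= M * h.
Proof.
intros H.
assert (Hx := C_rectangle_px _ _ _ _ H); assert (Hxx := C_rectangle_px _ _ _ _ Hx).
assert (Hxxx := C_rectangle_px _ _ _ _ Hxx).
destruct (C_rectangle_bounded _ _ _ _ Hxxx) as (M & HM & Hb).
exists (2 * M); split; [lra|].
intros Ms t HMs Ht h.
exact (boundary_defect _ _ _ _ M Ms
  (C_rectangle_dx _ _ t H Ht) (C_rectangle_dx _ _ t Hx Ht)
  (C_rectangle_dx _ _ t Hxx Ht) HM (fun x Hx => Hb x t Hx Ht) HMs).
Qed.

Lemma trapezoid_consistent u : C_rectangle 3 x_r D u ->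
  exists M, 0 <= M /\ forall Mt k x, (1 <= Mt)%nat -> (1 <= k <= Mt)%nat ->
  0 <= x <= x_r ->
  let tau := D / INR Mt in
  Rabs (mid (fun l => partial_t D u x (INR l * tau)) k
        - delta tau (fun l => u x (INR l * tau)) k) <= M * tau ^ 2.
Proof.
intros H.
assert (H1 := C_rectangle_pt _ _ _ _ H); assert (H2 := C_rectangle_pt _ _ _ _ H1).
assert (H3 := C_rectangle_pt _ _ _ _ H2).
destruct (C_rectangle_bounded _ _ _ _ H3) as (M & HM & Hb).
exists (2 * M); split; [lra|].
intros Mt k x HMt Hk Hx tau.
exact (trapezoid_defect _ _ _ _ M Mt k
  (C_rectangle_dt _ _ x H Hx) (C_rectangle_dt _ _ x H1 Hx)
  (C_rectangle_dt _ _ x H2 Hx) HM (fun t Ht => Hb x t Hx Ht) HMt Hk).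
Qed.

(** The trapezoidal rule is applied to the increment [T(x_i, .) - T(x_(i-1), .)],
    whose third time derivative is [h] times a value of [partial_x T_ttt]; dividing
    by [h] keeps the bound independent of the space step. *)
Lemma mixed_consistent u : C_rectangle 4 x_r D u ->
  exists M, 0 <= M /\ forall Mt Ms i k,
  (1 <= Mt)%nat -> (1 <= k <= Mt)%nat -> (1 <= Ms)%nat -> (1 <= i <= Ms)%nat ->
  let tau := D / INR Mt in let h := x_r / INR Ms in
  Rabs (compat_res tau h (fun j l => u (INR j * h) (INR l * tau))
          (fun j l => partial_t D u (INR j * h) (INR l * tau)) i k) <= M * tau ^ 2.
Proof.
intros H.
assert (H1 := C_rectangle_pt _ _ _ _ H); assert (H2 := C_rectangle_pt _ _ _ _ H1).
assert (H3 := C_rectangle_pt _ _ _ _ H2).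
assert (H4 := C_rectangle_px _ _ _ _ H3).
destruct (C_rectangle_bounded _ _ _ _ H4) as (M & HM & Hb).
exists (2 * M); split; [lra|].
intros Mt Ms i k HMt Hk HMs Hi tau h.
assert (Hh : 0 < h) by (apply Rdiv_lt_0_compat; [lra|apply lt_0_INR; lia]).
assert (Htau : 0 < tau) by (apply Rdiv_lt_0_compat; [lra|apply lt_0_INR; lia]).
assert (Hx := grid_point x_r Ms i Hxr HMs (proj2 Hi)).
assert (Hx0 := grid_point x_r Ms (i - 1) Hxr HMs ltac:(lia)).
fold h in Hx, Hx0.
set (x := INR i * h) in *; set (x0 := INR (i - 1) * h) in *.
assert (Hxx : x - x0 = h) by (unfold x, x0; rewrite grid_pred by lia; ring).
assert (X := trapezoid_defect (fun t => u x t - u x0 t)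
  (fun t => partial_t D u x t - partial_t D u x0 t)
  (fun t => partial_t D (partial_t D u) x t - partial_t D (partial_t D u) x0 t)
  (fun t => partial_t D (partial_t D (partial_t D u)) x t
            - partial_t D (partial_t D (partial_t D u)) x0 t)
  (M * h) Mt k).
cbv zeta in X; fold tau in X.
unfold compat_res.
match goal with |- Rabs ?A <= _ => replace A with
  (/ h * (mid (fun l => partial_t D u x (INR l * tau) - partial_t D u x0 (INR l * tau)) k
          - delta tau (fun l => u x (INR l * tau) - u x0 (INR l * tau)) k)) end.
2: { unfold delta, mid; fold x x0; field; lra. }
rewrite Rabs_mult, Rabs_pos_eq by (left; apply Rinv_0_lt_compat; lra).
apply (Rmult_le_reg_l h); [lra|].
rewrite <- Rmult_assoc, Rinv_r, Rmult_1_l by lra.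
eapply Rle_trans; [apply X|right; ring]; auto.
- exact (deriv_on_minus _ _ _ _ _ _
           (C_rectangle_dt _ _ x H Hx) (C_rectangle_dt _ _ x0 H Hx0)).
- exact (deriv_on_minus _ _ _ _ _ _
           (C_rectangle_dt _ _ x H1 Hx) (C_rectangle_dt _ _ x0 H1 Hx0)).
- exact (deriv_on_minus _ _ _ _ _ _
           (C_rectangle_dt _ _ x H2 Hx) (C_rectangle_dt _ _ x0 H2 Hx0)).
- apply Rmult_le_pos; lra.
- intros t Ht.
  assert (Y := taylor0 0 x_r M x0 Hx0 HM _ _ (C_rectangle_dx _ _ t H3 Ht)
    (fun y Hy => Hb y t Hy Ht) x Hx).
  cbv beta in Y; rewrite Hxx, pow_1, (Rabs_pos_eq h) in Y by lra; exact Y.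
Qed.

Lemma trapezoid_consistent_1d n f : C_interval (S (S (S n))) 0 D f ->
  exists M, 0 <= M /\ forall Mt k, (1 <= Mt)%nat -> (1 <= k <= Mt)%nat ->
  let tau := D / INR Mt in
  Rabs (mid (fun l => Derive_within 0 D f (INR l * tau)) k
        - delta tau (fun l => f (INR l * tau)) k) <= M * tau ^ 2.
Proof.
intros (_ & D0 & _ & D1 & _ & D2 & H3).
destruct (C_interval_bounded _ _ _ _ H3) as (M & HM & Hb).
exists (2 * M); split; [lra|].
intros Mt k HMt Hk tau.
eapply trapezoid_defect; eauto; intros t Ht; apply Derive_within_correct; auto.
Qed.

End Truncation.

(** * Local energy inequalities *)

Lemma coef_b_pos N n : (1 <= n <= N)%nat -> 0 < coef_b N n.
Proof.
intros H; unfold coef_b.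
apply pow_lt, cos_gt_0.
- apply Rlt_trans with 0; [pose proof PI_RGT_0; lra|].
  apply Rdiv_lt_0_compat; [|apply lt_0_INR; lia].
  apply Rmult_lt_0_compat; [apply lt_0_INR; lia|apply PI_RGT_0].
- apply Rmult_lt_reg_r with (INR (2 * N + 1)); [apply lt_0_INR; lia|].
  unfold Rdiv at 1; rewrite Rmult_assoc, Rinv_l, Rmult_1_r;
    [|apply not_0_INR; lia].
  assert (Hn : INR n + INR n < INR (2 * N + 1))
    by (rewrite <- plus_INR; apply lt_INR; lia).
  apply (Rmult_lt_compat_r PI) in Hn; [|exact PI_RGT_0].
  lra.
Qed.

(** This relation between the two families of coefficients makes the boundary form
    a sum of squares. *)
Lemma coef_a_eq N n : coef_a N n = 2 / INR (2 * N + 1) * (1 - coef_b N n).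
Proof.
unfold coef_a, coef_b.
pose proof (sin2_cos2 (INR n * PI / INR (2 * N + 1))) as H.
unfold Rsqr in H; f_equal; rewrite <- H; ring.
Qed.

Lemma coef_b_le1 N n : coef_b N n <= 1.
Proof.
unfold coef_b; pose proof (COS_bound (INR n * PI / INR (2 * N + 1))); nra.
Qed.

Lemma coef_a_nonneg N n : 0 <= coef_a N n.
Proof.
rewrite coef_a_eq; pose proof (coef_b_le1 N n).
apply Rmult_le_pos; [|lra].
apply Rmult_le_pos; [lra|]; left; apply Rinv_0_lt_compat, lt_0_INR; lia.
Qed.

Section Step.
Variables (a b K z0 gam tau theta : R) (N : nat).
Hypotheses (Ha : 0 < a) (Hb : 0 < b) (HK : 0 < K) (Hz0 : 0 < z0)
  (Hgam : 0 < gam) (Htau : 0 < tau) (Htheta : 0 < theta).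

Lemma young p x c : 0 < c -> p * x <= c * x ^ 2 + p ^ 2 / (4 * c).
Proof.
intros Hc.
assert (E : c * x ^ 2 + p ^ 2 / (4 * c) - p * x
            = (2 * c * x - p) ^ 2 / (4 * c)) by (field; lra).
assert (0 <= (2 * c * x - p) ^ 2 / (4 * c)).
{ apply Rmult_le_pos; [apply pow2_ge_0|left; apply Rinv_0_lt_compat; lra]. }
lra.
Qed.

(** The product that is left when [dw] replaces the difference quotient of [d] in
    [K d (d' - dw)]; it is paid for by the energy, with the small weight [theta],
    because the scheme does not damp [d]. *)
Lemma compat_step d1 d0 dw : 
  K * ((d1 + d0) / 2) * ((d1 - d0) / tau - dw)
  <= theta / 2 * (K / 2 * d1 ^ 2 + K / 2 * d0 ^ 2)
     + K / (2 * theta) * (dw - (d1 - d0) / tau) ^ 2.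
Proof.
set (g := dw - (d1 - d0) / tau).
replace ((d1 - d0) / tau - dw) with (- g) by (unfold g; ring).
assert (Y := young (- g) ((d1 + d0) / 2) (theta / 2) ltac:(lra)).
assert (((d1 + d0) / 2) ^ 2 <= (d1 ^ 2 + d0 ^ 2) / 2).
{ pose proof (pow2_ge_0 (d1 - d0)); nra. }
replace ((- g) ^ 2 / (4 * (theta / 2))) with (g ^ 2 / (2 * theta)) in Y
  by (field; lra).
apply Rle_trans with (K * (theta / 2 * ((d1 ^ 2 + d0 ^ 2) / 2) + g ^ 2 / (2 * theta))).
- rewrite Rmult_assoc; apply Rmult_le_compat_l; [lra|].
  assert (theta / 2 * ((d1 + d0) / 2) ^ 2 <= theta / 2 * ((d1 ^ 2 + d0 ^ 2) / 2))
    by (apply Rmult_le_compat_l; lra).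
  lra.
- right; field; lra.
Qed.

(** The heat equation at an interior node, tested with [h w].  Here [d1], [d0] and
    [dw] are the space differences to the left neighbour [wm], and [den], [dwn]
    those to the right neighbour.  The flux terms are the summation by parts in
    local form: they telescope along the grid. *)
Lemma interior_step h w1 w0 wm d1 d0 den dw dwn p : 0 < h ->
  let w := (w1 + w0) / 2 in let de := (d1 + d0) / 2 in
  w + a * ((w1 - w0) / tau) - K * ((den - de) / h + b * ((dwn - dw) / h)) = p ->
  h * dw = w - wm ->
  (h * (a / 2 * w1 ^ 2 + K / 2 * d1 ^ 2)
   - h * (a / 2 * w0 ^ 2 + K / 2 * d0 ^ 2)) / tau
  <= K * w * (den + b * dwn) - K * wm * (de + b * dw)
     + (theta / 2 * (h * (a / 2 * w1 ^ 2 + K / 2 * d1 ^ 2)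
                     + h * (a / 2 * w0 ^ 2 + K / 2 * d0 ^ 2))
        + h * (p ^ 2 / 4 + K / (2 * theta) * (dw - (d1 - d0) / tau) ^ 2)).
Proof.
intros Hh w de Hp Hw.
assert (Hc := compat_step d1 d0 dw).
assert (Hy := young p w 1 Rlt_0_1).
assert (E : (h * (a / 2 * w1 ^ 2 + K / 2 * d1 ^ 2)
             - h * (a / 2 * w0 ^ 2 + K / 2 * d0 ^ 2)) / tau
   = K * w * (den + b * dwn) - K * wm * (de + b * dw)
     + h * (p * w - w ^ 2 + K * de * ((d1 - d0) / tau - dw) - K * b * dw ^ 2)).
{ replace wm with (w - h * dw) by lra; rewrite <- Hp; unfold w, de; field; lra. }
rewrite E; apply Rplus_le_compat_l.
replace (4 * 1) with 4 in Hy by ring.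
fold de in Hc.
assert (0 <= K * b * dw ^ 2).
{ apply Rmult_le_pos; [apply Rmult_le_pos; lra|apply pow2_ge_0]. }
assert (0 <= theta / 2 * (a / 2 * w1 ^ 2 + a / 2 * w0 ^ 2)).
{ pose proof (pow2_ge_0 w1); pose proof (pow2_ge_0 w0).
  apply Rmult_le_pos; [lra|]; apply Rplus_le_le_0_compat; apply Rmult_le_pos; lra. }
apply Rle_trans with (h * (theta / 2 * (a / 2 * w1 ^ 2 + a / 2 * w0 ^ 2)
   + theta / 2 * (K / 2 * d1 ^ 2 + K / 2 * d0 ^ 2) + p ^ 2 / 4
   + K / (2 * theta) * (dw - (d1 - d0) / tau) ^ 2)).
- apply Rmult_le_compat_l; lra.
- right; ring.
Qed.

(** The boundary equation, tested with [h/2 w]: the half weight is the factor for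
    which its flux cancels the one left over by the interior nodes. *)
Lemma boundary_step h w1 w0 wm d1 d0 dw A B p : 0 < h ->
  let w := (w1 + w0) / 2 in let de := (d1 + d0) / 2 in
  w + a * ((w1 - w0) / tau)
  - 2 * K / h * (- de - b * dw - gam * (A * w - B)) = p ->
  h * dw = w - wm ->
  (h * (a / 4 * w1 ^ 2 + K / 2 * d1 ^ 2)
   - h * (a / 4 * w0 ^ 2 + K / 2 * d0 ^ 2)) / tau
  <= - (K * wm * (de + b * dw)) - K * gam * (A * w ^ 2 - B * w) + h * p / 2 * w
     + (theta / 2 * (h * (a / 4 * w1 ^ 2 + K / 2 * d1 ^ 2)
                     + h * (a / 4 * w0 ^ 2 + K / 2 * d0 ^ 2))
        + h * (K / (2 * theta) * (dw - (d1 - d0) / tau) ^ 2)).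
Proof.
intros Hh w de Hp Hw.
assert (Hc := compat_step d1 d0 dw).
assert (E : (h * (a / 4 * w1 ^ 2 + K / 2 * d1 ^ 2)
             - h * (a / 4 * w0 ^ 2 + K / 2 * d0 ^ 2)) / tau
   = - (K * wm * (de + b * dw)) - K * gam * (A * w ^ 2 - B * w) + h * p / 2 * w
     + h * (- (w ^ 2 / 2) + K * de * ((d1 - d0) / tau - dw) - K * b * dw ^ 2)).
{ replace wm with (w - h * dw) by lra; rewrite <- Hp; unfold w, de; field; lra. }
rewrite E; apply Rplus_le_compat_l.
fold de in Hc.
assert (0 <= K * b * dw ^ 2).
{ apply Rmult_le_pos; [apply Rmult_le_pos; lra|apply pow2_ge_0]. }
pose proof (pow2_ge_0 w).
assert (0 <= theta / 2 * (a / 4 * w1 ^ 2 + a / 4 * w0 ^ 2)).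
{ pose proof (pow2_ge_0 w1); pose proof (pow2_ge_0 w0).
  apply Rmult_le_pos; [lra|]; apply Rplus_le_le_0_compat; apply Rmult_le_pos; lra. }
apply Rle_trans with (h * (theta / 2 * (a / 4 * w1 ^ 2 + a / 4 * w0 ^ 2)
   + theta / 2 * (K / 2 * d1 ^ 2 + K / 2 * d0 ^ 2)
   + K / (2 * theta) * (dw - (d1 - d0) / tau) ^ 2)).
- apply Rmult_le_compat_l; lra.
- right; ring.
Qed.

(** An auxiliary equation, tested with [K gam z0 (al/be) s].  The coupling to [w] is
    completed to the square [(kap/be) (w - (1 - be) z0 s)^2], which is dropped; the
    price [(kap + al/be) w^2] sums to less than the boundary form provides.  The
    damping [be (a + b) s^2] absorbs the residual [q]. *)
Lemma auxiliary_step kap be s1 s0 r1 r0 w q : 0 <= kap -> 0 < be <= 1 ->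
  let s := (s1 + s0) / 2 in let r := (r1 + r0) / 2 in
  let al := kap * (1 - be) in
  (z0 - be * z0) * s + be * (r + (a + b) * s + a * b * ((s1 - s0) / tau)) - w = q ->
  (K * gam * z0 * al * (r1 ^ 2 / 2 + a * b * s1 ^ 2 / 2)
   - K * gam * z0 * al * (r0 ^ 2 / 2 + a * b * s0 ^ 2 / 2)) / tau
  <= K * gam * ((kap + al / be) * w ^ 2 - z0 * (al / be * s) * w)
     + (theta / 2 * (K * gam * z0 * al * (r1 ^ 2 / 2 + a * b * s1 ^ 2 / 2)
                     + K * gam * z0 * al * (r0 ^ 2 / 2 + a * b * s0 ^ 2 / 2))
        + K * gam * z0 * (al / be) *
            (q ^ 2 / (4 * (be * (a + b)))
             + be / (2 * theta) * (s - (r1 - r0) / tau) ^ 2)).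
Proof.
intros Hkap Hbe s r al Hq.
set (l := s - (r1 - r0) / tau).
assert (Hal : 0 <= al) by (apply Rmult_le_pos; lra).
assert (HKg : 0 < K * gam) by (apply Rmult_lt_0_compat; lra).
assert (Hz : 0 <= z0 * (al / be)).
{ apply Rmult_le_pos; [lra|]; apply Rmult_le_pos; [lra|].
  left; apply Rinv_0_lt_compat; lra. }
assert (E : (K * gam * z0 * al * (r1 ^ 2 / 2 + a * b * s1 ^ 2 / 2)
   - K * gam * z0 * al * (r0 ^ 2 / 2 + a * b * s0 ^ 2 / 2)) / tau
   = K * gam * ((kap + al / be) * w ^ 2 - z0 * (al / be * s) * w)
     + K * gam * (- (kap / be * (w - (1 - be) * z0 * s) ^ 2)
        + z0 * (al / be) * (q * s - be * (a + b) * s ^ 2 - be * (r * l)))).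
{ rewrite <- Hq; unfold l, al, s, r; field; lra. }
rewrite E; apply Rplus_le_compat_l.
assert (Hab : 0 < be * (a + b)) by (apply Rmult_lt_0_compat; lra).
assert (Y1 := young q s (be * (a + b)) Hab).
assert (Y2 := young (- l) r (theta / 2) ltac:(lra)).
replace ((- l) ^ 2 / (4 * (theta / 2))) with (l ^ 2 / (2 * theta)) in Y2
  by (field; lra).
assert (r ^ 2 <= (r1 ^ 2 + r0 ^ 2) / 2).
{ pose proof (pow2_ge_0 (r1 - r0)); unfold r; nra. }
assert (Y3 : theta / 2 * r ^ 2 <= theta / 2 * ((r1 ^ 2 + r0 ^ 2) / 2)).
{ apply Rmult_le_compat_l; lra. }
assert (Y4 : be * (- l * r) <= be * (theta / 2 * ((r1 ^ 2 + r0 ^ 2) / 2) + l ^ 2 / (2 * theta))).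
{ apply Rmult_le_compat_l; lra. }
assert (P1 : 0 <= kap / be * (w - (1 - be) * z0 * s) ^ 2).
{ apply Rmult_le_pos; [|apply pow2_ge_0].
  apply Rmult_le_pos; [lra|left; apply Rinv_0_lt_compat; lra]. }
assert (P2 : 0 <= be * (theta / 2 * (a * b * s1 ^ 2 / 2 + a * b * s0 ^ 2 / 2))).
{ assert (0 < a * b) by (apply Rmult_lt_0_compat; lra).
  pose proof (pow2_ge_0 s1); pose proof (pow2_ge_0 s0).
  apply Rmult_le_pos; [lra|]; apply Rmult_le_pos; [lra|]; nra. }
apply Rle_trans with (K * gam * (z0 * (al / be) *
  (be * (theta / 2 * ((r1 ^ 2 + r0 ^ 2) / 2) + l ^ 2 / (2 * theta))
   + q ^ 2 / (4 * (be * (a + b)))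
   + be * (theta / 2 * (a * b * s1 ^ 2 / 2 + a * b * s0 ^ 2 / 2))))).
- apply Rmult_le_compat_l; [lra|].
  apply Rle_trans with (0 + z0 * (al / be) * (q * s - be * (a + b) * s ^ 2 - be * (r * l)));
    [lra|].
  rewrite Rplus_0_l; apply Rmult_le_compat_l; [assumption|]; lra.
- right; field; lra.
Qed.
End Step.

(** * Unconditional stability *)

Definition energy (a b K z0 h : R) (N Ms : nat) (e w r s : nat -> nat -> R)
    (k : nat) : R :=
  sum_n_m (fun i => h * (a / 2 * w i k ^ 2
                         + K / 2 * delta h (fun j => e j k) i ^ 2)) 1 (Ms - 1)
  + h * (a / 4 * w Ms k ^ 2 + K / 2 * delta h (fun j => e j k) Ms ^ 2)
  + sum_n_m (fun n => K * sqrt (z0 / K) * z0 * coef_a N n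
                      * (r n k ^ 2 / 2 + a * b * s n k ^ 2 / 2)) 1 N.

(** The factor of [eps^2] in the energy inequality: the heat and compatibility
    residuals over an interval of length [L], the boundary residual, and the
    auxiliary equations, each as left by Young's inequality. *)
Definition source_const (a b K z0 L theta : R) (N : nat) : R :=
  L * (/ 4 + K / (2 * theta))
  + INR (2 * N + 1) / (4 * (K * sqrt (z0 / K)))
  + sum_n_m (fun n => K * sqrt (z0 / K) * z0 * (coef_a N n / coef_b N n)
       * (/ (4 * (coef_b N n * (a + b))) + coef_b N n / (2 * theta))) 1 N.

Section Energy.
Variables (a b K z0 tau theta h eps : R) (N Mt Ms : nat).
Hypotheses (Ha : 0 < a) (Hb : 0 < b) (HK : 0 < K) (Hz0 : 0 < z0)
  (Htau : 0 < tau) (Htheta : 0 < theta) (Hh : 0 < h) (HMs : (1 <= Ms)%nat).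
Variables (e w r s : nat -> nat -> R).
Hypothesis H : small_residuals a b K z0 tau h eps N Mt Ms e w r s.

Let gam := sqrt (z0 / K).
Let Hgam : 0 < gam.
Proof. apply sqrt_lt_R0, Rdiv_lt_0_compat; assumption. Qed.

Lemma energy_nonneg k : 0 <= energy a b K z0 h N Ms e w r s k.
Proof.
unfold energy; apply Rplus_le_le_0_compat; [apply Rplus_le_le_0_compat|].
- apply sum_nonneg; intros i _.
  pose proof (pow2_ge_0 (w i k)); pose proof (pow2_ge_0 (delta h (fun j => e j k) i)).
  apply Rmult_le_pos; [lra|]; apply Rplus_le_le_0_compat; apply Rmult_le_pos; lra.
- pose proof (pow2_ge_0 (w Ms k)); pose proof (pow2_ge_0 (delta h (fun j => e j k) Ms)).
  apply Rmult_le_pos; [lra|]; apply Rplus_le_le_0_compat; apply Rmult_le_pos; lra.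
- fold gam; apply sum_nonneg; intros n _; pose proof (coef_a_nonneg N n).
  pose proof (pow2_ge_0 (r n k)); pose proof (pow2_ge_0 (s n k)).
  assert (0 < a * b) by (apply Rmult_lt_0_compat; lra).
  assert (0 < K * gam * z0) by (repeat apply Rmult_lt_0_compat; lra).
  apply Rmult_le_pos; [apply Rmult_le_pos; lra|].
  apply Rplus_le_le_0_compat; [lra|].
  apply Rmult_le_pos; [apply Rmult_le_pos; lra|lra].
Qed.

Lemma interior_energy_step k : (1 <= k <= Mt)%nat ->
  let dens l i := h * (a / 2 * w i l ^ 2 + K / 2 * delta h (fun j => e j l) i ^ 2) in
  let de := delta h (fun j => mid (e j) k) in
  let dw := delta h (fun j => mid (w j) k) in
  (sum_n_m (dens k) 1 (Ms - 1) - sum_n_m (dens (k - 1)%nat) 1 (Ms - 1)) / tau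
  <= K * mid (w (Ms - 1)%nat) k * (de Ms + b * dw Ms)
     + theta / 2 * (sum_n_m (dens k) 1 (Ms - 1) + sum_n_m (dens (k - 1)%nat) 1 (Ms - 1))
     + INR (Ms - 1) * (h * ((/ 4 + K / (2 * theta)) * eps ^ 2)).
Proof.
intros Hk dens de dw.
set (J i := K * mid (w i) k * (de (S i) + b * dw (S i))).
assert (X := sum_telescope_le
  (fun i => / tau * (dens k i - dens (k - 1)%nat i))
  (fun i => theta / 2 * (dens k i + dens (k - 1)%nat i)
            + h * ((/ 4 + K / (2 * theta)) * eps ^ 2)) J (Ms - 1)).
rewrite sum_scal, sum_sub, sum_add, sum_scal, sum_add, sum_n_m_const in X.
replace (S (Ms - 1) - 1)%nat with (Ms - 1)%nat in X by lia.
assert (HJ : J (Ms - 1)%nat - J 0%nat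
             = K * mid (w (Ms - 1)%nat) k * (de Ms + b * dw Ms)).
{ unfold J; replace (S (Ms - 1)) with Ms by lia.
  destruct (sr_left H k ltac:(lia)) as [_ E1].
  destruct (sr_left H (k - 1)%nat ltac:(lia)) as [_ E0].
  replace (mid (w 0%nat) k) with 0 by (unfold mid; rewrite E1, E0; field); ring. }
rewrite HJ in X; unfold Rdiv at 1; rewrite Rmult_comm.
eapply Rle_trans; [apply X|right; ring].
intros i Hi.
assert (Hp := sr_heat H i k ltac:(lia) ltac:(lia)).
assert (Hg := sr_compat H i k ltac:(lia) ltac:(lia)).
apply sqr_bound in Hp; apply sqr_bound in Hg.
set (p := heat_res a b K tau h e w i k) in Hp.
set (d1 := delta h (fun j => e j k) i).
set (d0 := delta h (fun j => e j (k - 1)%nat) i).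
assert (Ede : de i = (d1 + d0) / 2).
{ unfold de, d1, d0, delta, mid; field; lra. }
assert (Ec : compat_res tau h e w i k = dw i - (d1 - d0) / tau).
{ unfold compat_res, dw, d1, d0, delta, mid; field; lra. }
rewrite Ec in Hg.
assert (Y := interior_step a b K tau theta Ha Hb HK Htau Htheta h
  (w i k) (w i (k - 1)%nat) (mid (w (i - 1)%nat) k) d1 d0
  (de (S i)) (dw i) (dw (S i)) p Hh).
cbv zeta in Y; rewrite <- Ede in Y.
unfold J; replace (S (i - 1)) with i by lia.
change ((w i k + w i (k - 1)%nat) / 2) with (mid (w i) k) in Y.
rewrite (Rmult_comm (/ tau)).
eapply Rle_trans; [apply Y|].
- reflexivity.
- unfold dw, delta; field; lra.
- unfold dens; fold d1 d0; apply Rplus_le_compat_l, Rplus_le_compat_l, Rmult_le_compat_l; [lra|].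
  assert (0 < K / (2 * theta)) by (apply Rdiv_lt_0_compat; lra).
  apply (Rmult_le_compat_l (K / (2 * theta))) in Hg; lra.
Qed.

(** The coefficients [kap] sum to [2N/(2N+1)], which leaves the fraction
    [1/(2N+1)] of the boundary term [w^2]. *)
Lemma auxiliary_energy_step k : (1 <= k <= Mt)%nat ->
  let aux l n := K * gam * z0 * coef_a N n * (r n l ^ 2 / 2 + a * b * s n l ^ 2 / 2) in
  let wM := mid (w Ms) k in
  (sum_n_m (aux k) 1 N - sum_n_m (aux (k - 1)%nat) 1 N) / tau
  <= K * gam * ((1 + sum_ab N - / INR (2 * N + 1)) * wM ^ 2
        - z0 * sum_n_m (fun n => coef_a N n / coef_b N n * mid (s n) k) 1 N * wM)
     + theta / 2 * (sum_n_m (aux k) 1 N + sum_n_m (aux (k - 1)%nat) 1 N)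
     + sum_n_m (fun n => K * gam * z0 * (coef_a N n / coef_b N n)
       * (/ (4 * (coef_b N n * (a + b))) + coef_b N n / (2 * theta))) 1 N * eps ^ 2.
Proof.
intros Hk aux wM.
assert (HN : 0 < INR (2 * N + 1)) by (apply lt_0_INR; lia).
set (kap := 2 / INR (2 * N + 1)).
assert (Hkap : 0 < kap) by (apply Rdiv_lt_0_compat; lra).
assert (X : sum_n_m (fun n => / tau * (aux k n - aux (k - 1)%nat n)) 1 N
  <= sum_n_m (fun n =>
       (K * gam * wM ^ 2 * (kap + coef_a N n / coef_b N n)
        - K * gam * z0 * wM * (coef_a N n / coef_b N n * mid (s n) k))
       + (theta / 2 * (aux k n + aux (k - 1)%nat n)
          + eps ^ 2 * (K * gam * z0 * (coef_a N n / coef_b N n)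
       * (/ (4 * (coef_b N n * (a + b))) + coef_b N n / (2 * theta))))) 1 N).
{ apply sum_le_loc; intros n Hn.
  assert (Hq := sr_zeta H n k Hn Hk).
  assert (Hl := sr_sigma H n k Hn Hk).
  apply sqr_bound in Hq; apply sqr_bound in Hl.
  assert (Hbp := coef_b_pos N n Hn); assert (Hb1 := coef_b_le1 N n).
  assert (Hap := coef_a_nonneg N n).
  assert (Y := auxiliary_step a b K z0 gam tau theta Ha Hb HK Hz0 Hgam Htau Htheta
    kap (coef_b N n) (s n k) (s n (k - 1)%nat) (r n k) (r n (k - 1)%nat) wM
    (zeta_res a b z0 tau N Ms w r s n k) (Rlt_le _ _ Hkap) (conj Hbp Hb1)).
  cbv zeta in Y.
  change (kap * (1 - coef_b N n)) with (2 / INR (2 * N + 1) * (1 - coef_b N n)) in Y.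
  rewrite <- coef_a_eq in Y.
  rewrite (Rmult_comm (/ tau)).
  eapply Rle_trans; [apply Y; reflexivity|].
  change ((s n k + s n (k - 1)%nat) / 2) with (mid (s n) k).
  change (mid (s n) k - (r n k - r n (k - 1)%nat) / tau)
    with (sigma_res tau r s n k).
  set (c := coef_b N n) in *.
  assert (0 <= K * gam * z0 * (coef_a N n / c)).
  { assert (0 < K * gam * z0) by (repeat apply Rmult_lt_0_compat; lra).
    apply Rmult_le_pos; [lra|]; apply Rmult_le_pos; [lra|].
    left; apply Rinv_0_lt_compat; lra. }
  assert (Hc1 : 0 < / (4 * (c * (a + b)))).
  { apply Rinv_0_lt_compat, Rmult_lt_0_compat; [lra|].
    apply Rmult_lt_0_compat; lra. }
  assert (Hc2 : 0 < c / (2 * theta)) by (apply Rdiv_lt_0_compat; lra).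
  apply (Rmult_le_compat_l (/ (4 * (c * (a + b))))) in Hq; [|lra].
  apply (Rmult_le_compat_l (c / (2 * theta))) in Hl; [|lra].
  apply Rle_trans with
    (K * gam * wM ^ 2 * (kap + coef_a N n / c)
     - K * gam * z0 * wM * (coef_a N n / c * mid (s n) k)
     + (theta / 2 * (aux k n + aux (k - 1)%nat n)
        + K * gam * z0 * (coef_a N n / c) *
          (/ (4 * (c * (a + b))) * eps ^ 2 + c / (2 * theta) * eps ^ 2)));
    [|right; ring].
  apply Rle_trans with
    (K * gam * wM ^ 2 * (kap + coef_a N n / c)
     - K * gam * z0 * wM * (coef_a N n / c * mid (s n) k)
     + (theta / 2 * (aux k n + aux (k - 1)%nat n)
        + K * gam * z0 * (coef_a N n / c) *
          (/ (4 * (c * (a + b))) * zeta_res a b z0 tau N Ms w r s n k ^ 2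
           + c / (2 * theta) * sigma_res tau r s n k ^ 2))).
  - right; unfold aux, Rdiv; ring.
  - apply Rplus_le_compat_l, Rplus_le_compat_l, Rmult_le_compat_l; [assumption|lra]. }
rewrite sum_scal, sum_sub, sum_add, sum_sub, !sum_scal, !sum_add,
  !sum_scal, sum_n_m_const, sum_add in X.
replace (S N - 1)%nat with N in X by lia.
assert (HE : INR N * kap = 1 - / INR (2 * N + 1)).
{ assert (E : INR (2 * N + 1) = 2 * INR N + 1)
    by (rewrite plus_INR, mult_INR; simpl; ring).
  unfold kap; rewrite E; field; rewrite <- E; lra. }
rewrite HE in X; change (sum_n_m (fun n => coef_a N n / coef_b N n) 1 N) with (sum_ab N) in X.
unfold Rdiv at 1; rewrite Rmult_comm.
eapply Rle_trans; [apply X|right; ring].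
Qed.

(** The telescoped interior flux cancels the boundary flux, and the remaining
    boundary dissipation [w^2/(2N+1)] absorbs the boundary residual. *)
Lemma energy_step k : (1 <= k <= Mt)%nat ->
  let Q := energy a b K z0 h N Ms e w r s in
  Q k - Q (k - 1)%nat
  <= tau * (theta / 2 * (Q k + Q (k - 1)%nat)
            + source_const a b K z0 (INR Ms * h) theta N * eps ^ 2).
Proof.
intros Hk Q.
assert (X1 := interior_energy_step k Hk); assert (X3 := auxiliary_energy_step k Hk).
cbv beta zeta in X1, X3.
set (p := right_res a b K z0 tau h N Ms e w s k).
assert (Hp := sr_right H k Hk); fold p in Hp.
assert (Hg := sr_compat H Ms k ltac:(lia) ltac:(lia)).
apply sqr_bound in Hp; apply sqr_bound in Hg.
set (d1 := delta h (fun j => e j k) Ms).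
set (d0 := delta h (fun j => e j (k - 1)%nat) Ms).
set (de := delta h (fun j => mid (e j) k)) in *.
set (dw := delta h (fun j => mid (w j) k)) in *.
assert (Ede : de Ms = (d1 + d0) / 2).
{ unfold de, d1, d0, delta, mid; field; lra. }
assert (Ec : compat_res tau h e w Ms k = dw Ms - (d1 - d0) / tau).
{ unfold compat_res, dw, d1, d0, delta, mid; field; lra. }
rewrite Ec in Hg.
set (Sg := sum_n_m (fun n => coef_a N n / coef_b N n * mid (s n) k) 1 N) in *.
assert (X2 := boundary_step a b K gam tau theta Ha Hb HK Htau Htheta h
  (w Ms k) (w Ms (k - 1)%nat) (mid (w (Ms - 1)%nat) k) d1 d0 (dw Ms)
  (1 + sum_ab N) (z0 * Sg) p Hh).
cbv zeta in X2; rewrite <- Ede in X2.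
change ((w Ms k + w Ms (k - 1)%nat) / 2) with (mid (w Ms) k) in X2.
specialize (X2 ltac:(unfold p, right_res; reflexivity)
              ltac:(unfold dw, delta; field; lra)).
set (wM := mid (w Ms) k) in *.
assert (HN : 0 < INR (2 * N + 1)) by (apply lt_0_INR; lia).
assert (HKg : 0 < K * gam) by (apply Rmult_lt_0_compat; lra).
assert (Y := young (h * p / 2) wM (K * gam * / INR (2 * N + 1))
  ltac:(apply Rmult_lt_0_compat; [lra|apply Rinv_0_lt_compat; lra])).
replace ((h * p / 2) ^ 2 / (4 * (K * gam * / INR (2 * N + 1))))
  with ((h * p) ^ 2 / 4 * (INR (2 * N + 1) / (4 * (K * gam)))) in Y
  by (field; lra).
assert (Hcb : 0 < INR (2 * N + 1) / (4 * (K * gam))) by (apply Rdiv_lt_0_compat; lra).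
assert (Y' : (h * p) ^ 2 / 4 * (INR (2 * N + 1) / (4 * (K * gam)))
             <= INR (2 * N + 1) / (4 * (K * gam)) * eps ^ 2).
{ rewrite Rmult_comm; apply Rmult_le_compat_l; [lra|].
  pose proof (pow2_ge_0 eps); lra. }
assert (Yg : h * (K / (2 * theta) * (dw Ms - (d1 - d0) / tau) ^ 2)
             <= h * ((/ 4 + K / (2 * theta)) * eps ^ 2)).
{ apply Rmult_le_compat_l; [lra|].
  assert (0 < K / (2 * theta)) by (apply Rdiv_lt_0_compat; lra).
  pose proof (pow2_ge_0 eps).
  apply (Rmult_le_compat_l (K / (2 * theta))) in Hg; lra. }
apply (Rmult_le_reg_l (/ tau)); [apply Rinv_0_lt_compat; lra|].
rewrite <- Rmult_assoc, Rinv_l, Rmult_1_l by lra.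
assert (HM : INR (Ms - 1) = INR Ms - 1) by (rewrite minus_INR; simpl; [ring|lia]).
rewrite HM in X1.
unfold Q, energy, source_const; fold gam; fold d1 d0.
set (I1 := sum_n_m _ 1 (Ms - 1)) in X1 |- *.
set (I0 := sum_n_m (fun i => h * (a / 2 * w i (k - 1)%nat ^ 2 + _)) 1 (Ms - 1))
  in X1 |- *.
set (A1 := sum_n_m (fun n => _ * (r n k ^ 2 / 2 + _)) 1 N) in X3 |- *.
set (A0 := sum_n_m (fun n => _ * (r n (k - 1)%nat ^ 2 / 2 + _)) 1 N) in X3 |- *.
set (C3 := sum_n_m (fun n => _ * (_ + coef_b N n / (2 * theta))) 1 N) in X3 |- *.
unfold Rdiv at 1 in X1; unfold Rdiv at 1 in X2; unfold Rdiv at 1 in X3.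
set (G := K * gam) in *.
lra.
Qed.
End Energy.

(** The implicit term can be moved to the left for every [n] because the step
    [x = 1/n] is at most 1: then [(1 + x/2) / (1 - x/2) <= 1 + 2x <= exp (2x)]. *)
Lemma crank_nicolson_gronwall (Q : nat -> R) (A : R) (n : nat) :
  (1 <= n)%nat -> 0 <= A -> Q 0%nat = 0 -> (forall k, 0 <= Q k) ->
  (forall k, (1 <= k <= n)%nat ->
     Q k - Q (k - 1)%nat <= / INR n * (/ 2 * (Q k + Q (k - 1)%nat) + A)) ->
  forall k, (k <= n)%nat -> Q k <= exp 2 * A.
Proof.
intros Hn HA HQ0 HQ Hstep.
set (x := / INR n).
assert (Hn1 : 1 <= INR n) by (apply (le_INR 1); lia).
assert (Hx : 0 < x <= 1).
{ split; [apply Rinv_0_lt_compat; lra|].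
  rewrite <- Rinv_1; apply Rinv_le_contravar; lra. }
assert (X : forall k, (k <= n)%nat -> Q k + A <= exp (INR k * (2 * x)) * A).
{ induction k as [|k IH]; intros Hk.
  - rewrite HQ0; simpl; rewrite Rmult_0_l, exp_0; lra.
  - specialize (IH ltac:(lia)); specialize (Hstep (S k) ltac:(lia)).
    fold x in Hstep; replace (S k - 1)%nat with k in Hstep by lia.
    rewrite S_INR, Rmult_plus_distr_r, Rmult_1_l, exp_plus.
    assert (Hexp := exp_ineq1 (2 * x) ltac:(lra)).
    apply Rle_trans with ((1 + 2 * x) * (Q k + A)).
    + apply (Rmult_le_reg_r (1 - x / 2)); [lra|].
      apply Rle_trans with ((1 + x / 2) * (Q k + A)); [lra|].
      assert (1 + x / 2 <= (1 + 2 * x) * (1 - x / 2)) by nra.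
      assert (0 <= Q k + A) by (specialize (HQ k); lra).
      nra.
    + apply Rle_trans with ((1 + 2 * x) * (exp (INR k * (2 * x)) * A)).
      * apply Rmult_le_compat_l; lra.
      * assert (0 <= exp (INR k * (2 * x)) * A).
        { apply Rmult_le_pos; [left; apply exp_pos|assumption]. }
        nra. }
intros k Hk; specialize (X k Hk).
apply Rle_trans with (exp (INR k * (2 * x)) * A); [lra|].
apply Rmult_le_compat_r; [assumption|].
assert (Hkx : INR k * (2 * x) <= 2).
{ assert (INR k <= INR n) by (apply le_INR; lia).
  assert (INR n * x = 1) by (unfold x; field; lra).
  nra. }
destruct Hkx as [Hlt|Heq]; [left; apply exp_increasing; exact Hlt|rewrite Heq; lra].
Qed.

(** A grid function vanishing at the left end is the sum of its increments. *)
Lemma grid_sobolev (h : R) (u : nat -> R) (M i : nat) :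
  0 < h -> (i <= M)%nat -> u 0%nat = 0 ->
  u i ^ 2 <= INR M * h * sum_n_m (fun j => h * delta h u j ^ 2) 1 M.
Proof.
intros Hh Hi H0.
assert (E : forall k, u k = sum_n_m (fun j => h * delta h u j) 1 k).
{ induction k as [|k IH]; [rewrite sum_1_0; exact H0|].
  rewrite sum_S, <- IH; unfold delta; replace (S k - 1)%nat with k by lia.
  field; lra. }
assert (Mono : sum_n_m (fun j => h * delta h u j ^ 2) 1 i
               <= sum_n_m (fun j => h * delta h u j ^ 2) 1 M).
{ clear E; induction Hi as [|M' _ IH]; [lra|].
  rewrite sum_S; pose proof (pow2_ge_0 (delta h u (S M'))); nra. }
assert (Pos : 0 <= sum_n_m (fun j => h * delta h u j ^ 2) 1 i).
{ apply sum_nonneg; intros j _; apply Rmult_le_pos; [lra|apply pow2_ge_0]. }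
rewrite (E i).
eapply Rle_trans; [apply sum_sqr_le|].
rewrite (sum_ext _ (fun j => h * (h * delta h u j ^ 2))) by (intros; ring).
rewrite sum_scal, <- Rmult_assoc.
apply le_INR in Hi; pose proof (pos_INR i).
apply Rmult_le_compat; auto.
- apply Rmult_le_pos; lra.
- apply Rmult_le_compat_r; lra.
Qed.

Lemma source_const_pos a b K z0 L theta N :
  0 < a -> 0 < b -> 0 < K -> 0 < z0 -> 0 < L -> 0 < theta ->
  0 < source_const a b K z0 L theta N.
Proof.
intros Ha Hb HK Hz0 HL Ht; unfold source_const.
assert (Hg : 0 < sqrt (z0 / K)) by (apply sqrt_lt_R0, Rdiv_lt_0_compat; assumption).
assert (0 < K / (2 * theta)) by (apply Rdiv_lt_0_compat; lra).
assert (0 < L * (/ 4 + K / (2 * theta))) by (apply Rmult_lt_0_compat; lra).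
assert (0 < K * sqrt (z0 / K)) by (apply Rmult_lt_0_compat; lra).
assert (0 < INR (2 * N + 1) / (4 * (K * sqrt (z0 / K)))).
{ apply Rdiv_lt_0_compat; [apply lt_0_INR; lia|lra]. }
match goal with |- 0 < _ + ?s => assert (0 <= s); [|lra] end.
apply sum_nonneg; intros n Hn.
assert (Hbp := coef_b_pos N n Hn); assert (Hap := coef_a_nonneg N n).
set (be := coef_b N n) in *; set (al := coef_a N n) in *; clearbody be al.
assert (0 < K * sqrt (z0 / K) * z0) by (apply Rmult_lt_0_compat; lra).
apply Rmult_le_pos.
- apply Rmult_le_pos; [lra|]; apply Rmult_le_pos; [lra|].
  left; apply Rinv_0_lt_compat; lra.
- assert (0 < be * (a + b)) by (apply Rmult_lt_0_compat; lra).
  assert (0 < / (4 * (be * (a + b)))) by (apply Rinv_0_lt_compat; lra).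
  assert (0 < be / (2 * theta)) by (apply Rdiv_lt_0_compat; lra).
  lra.
Qed.

(** The constant depends neither on the numbers of steps nor on a ratio between them:
    the weight [1/D] of the energy in Young's inequality makes the Gronwall
    factor [exp 2]. *)
Theorem stability (a b K z0 D L : R) (N : nat) :
  0 < a -> 0 < b -> 0 < K -> 0 < z0 -> 0 < D -> 0 < L ->
  exists C, 0 < C /\
    forall Mt Ms : nat, (1 <= Mt)%nat -> (1 <= Ms)%nat ->
    forall (eps : R) (e w r s : nat -> nat -> R),
    small_residuals a b K z0 (D / INR Mt) (L / INR Ms) eps N Mt Ms e w r s ->
    forall i m, (i <= Ms)%nat -> (m <= Mt)%nat -> e i m ^ 2 <= C * eps ^ 2.
Proof.
intros Ha Hb HK Hz0 HD HL.
set (S0 := source_const a b K z0 L (/ D) N).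
assert (HS : 0 < S0).
{ apply source_const_pos; auto; apply Rinv_0_lt_compat; assumption. }
exists (L * (2 / K) * (exp 2 * (D * S0))); split.
{ repeat apply Rmult_lt_0_compat; auto; try lra; try apply exp_pos.
  apply Rinv_0_lt_compat; assumption. }
intros Mt Ms HMt HMs eps e w r s H i m Hi Hm.
assert (HMt' : 0 < INR Mt) by (apply lt_0_INR; lia).
assert (HMs' : 0 < INR Ms) by (apply lt_0_INR; lia).
set (tau := D / INR Mt) in *; set (h := L / INR Ms) in *.
assert (Htau : 0 < tau) by (apply Rdiv_lt_0_compat; assumption).
assert (Hh : 0 < h) by (apply Rdiv_lt_0_compat; assumption).
assert (HhM : INR Ms * h = L) by (unfold h; field; lra).
set (Q := energy a b K z0 h N Ms e w r s).
assert (HQ : forall k, 0 <= Q k).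
{ intros k; apply energy_nonneg; auto. }
assert (HQ0 : Q 0%nat = 0).
{ unfold Q, energy.
  assert (I := sr_init H).
  assert (I' := sr_init_aux H).
  assert (Hd : forall j, (1 <= j <= Ms)%nat -> delta h (fun j => e j 0%nat) j = 0).
  { intros j Hj; unfold delta; rewrite (proj1 (I j ltac:(lia))),
      (proj1 (I (j - 1)%nat ltac:(lia))); field; lra. }
  rewrite (sum_ext _ (fun _ => 0)), (sum_ext (fun n => _ * (r n 0%nat ^ 2 / 2 + _)) (fun _ => 0)).
  - rewrite !sum_n_m_const, Hd, (proj2 (I Ms ltac:(lia))) by lia; ring.
  - intros n Hn; destruct (I' n Hn) as [-> ->]; field.
  - intros j Hj; rewrite Hd, (proj2 (I j ltac:(lia))) by lia; ring. }
assert (HQm : Q m <= exp 2 * (D * (S0 * eps ^ 2))).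
{ apply (crank_nicolson_gronwall Q _ Mt); auto.
  - apply Rmult_le_pos; [lra|]; apply Rmult_le_pos; [lra|apply pow2_ge_0].
  - intros k Hk.
    assert (X := energy_step a b K z0 tau (/ D) h eps N Mt Ms Ha Hb HK Hz0 Htau
      (Rinv_0_lt_compat _ HD) Hh HMs e w r s H k Hk).
    cbv zeta in X; fold Q in X; rewrite HhM in X; fold S0 in X.
    eapply Rle_trans; [apply X|right]; unfold tau; field; lra. }
assert (HG := grid_sobolev h (fun j => e j m) Ms i Hh Hi
  (proj1 (sr_left H m Hm))).
rewrite HhM in HG; cbv beta in HG.
assert (HE : K / 2 * sum_n_m (fun j => h * delta h (fun j => e j m) j ^ 2) 1 Ms <= Q m).
{ unfold Q, energy; replace Ms with (S (Ms - 1)) at 1 by lia.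
  rewrite sum_S, Rmult_plus_distr_l, <- sum_scal.
  replace (S (Ms - 1)) with Ms by lia.
  match goal with |- _ <= _ + _ + ?t => assert (0 <= t) end.
  { apply sum_nonneg; intros n _; assert (Hap := coef_a_nonneg N n).
    set (al := coef_a N n) in *; clearbody al.
    assert (Hg : 0 < sqrt (z0 / K)) by (apply sqrt_lt_R0, Rdiv_lt_0_compat; assumption).
    assert (0 < K * sqrt (z0 / K) * z0) by (repeat apply Rmult_lt_0_compat; lra).
    assert (0 < a * b) by (apply Rmult_lt_0_compat; lra).
    pose proof (pow2_ge_0 (r n m)); pose proof (pow2_ge_0 (s n m)).
    apply Rmult_le_pos; [apply Rmult_le_pos; lra|].
    apply Rplus_le_le_0_compat; [lra|].
    apply Rmult_le_pos; [apply Rmult_le_pos; lra|lra]. }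
  match goal with |- ?x + ?y <= ?u + ?v + ?t =>
    assert (x <= u); [|assert (y <= v); [|lra]] end.
  - apply sum_le_loc; intros j _; pose proof (pow2_ge_0 (w j m)).
    assert (0 <= h * (a / 2 * w j m ^ 2))
      by (apply Rmult_le_pos; [|apply Rmult_le_pos]; lra).
    lra.
  - pose proof (pow2_ge_0 (w Ms m)).
    assert (0 <= h * (a / 4 * w Ms m ^ 2))
      by (apply Rmult_le_pos; [|apply Rmult_le_pos]; lra).
    lra. }
set (X := sum_n_m _ 1 Ms) in HG, HE.
apply Rle_trans with (L * (2 / K * Q m)).
- eapply Rle_trans; [apply HG|]; apply Rmult_le_compat_l; [lra|].
  apply (Rmult_le_compat_l (2 / K)) in HE; [|left; apply Rdiv_lt_0_compat; lra].
  assert (F : forall x, x = 2 / K * (K / 2 * x)) by (intros; field; lra).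
  rewrite (F X); exact HE.
- rewrite !Rmult_assoc; apply Rmult_le_compat_l; [lra|].
  apply Rmult_le_compat_l; [left; apply Rdiv_lt_0_compat; lra|exact HQm].
Qed.

(** * Consistency *)

Definition on_grid (h tau : R) (u : R -> R -> R) (i k : nat) : R :=
  u (INR i * h) (INR k * tau).

Definition on_mesh (tau : R) (v : nat -> R -> R) (n k : nat) : R :=
  v n (INR k * tau).

Lemma Rabs_add_le x y X Y :
  Rabs x <= X -> Rabs y <= Y -> Rabs (x + y) <= X + Y.
Proof. intros; eapply Rle_trans; [apply Rabs_triang|lra]. Qed.

Lemma Rabs_mul_le c x X : Rabs x <= X -> Rabs (c * x) <= Rabs c * X.
Proof.
intros; rewrite Rabs_mult; apply Rmult_le_compat_l; [apply Rabs_pos|assumption].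
Qed.

Lemma sum_mid (c : nat -> R) (v : nat -> nat -> R) k N :
  sum_n_m (fun n => c n * mid (v n) k) 1 N
  = mid (fun l => sum_n_m (fun n => c n * v n l) 1 N) k.
Proof.
rewrite (sum_ext _ (fun n => / 2 * (c n * v n k + c n * v n (k - 1)%nat)))
  by (intros; unfold mid; field).
rewrite sum_scal, sum_add; apply Rmult_comm.
Qed.

Lemma uniform_bound (P : nat -> R -> Prop) N :
  (forall n M M', M <= M' -> P n M -> P n M') ->
  (forall n, (1 <= n <= N)%nat -> exists M, 0 <= M /\ P n M) ->
  exists M, 0 <= M /\ forall n, (1 <= n <= N)%nat -> P n M.
Proof.
intros Hmono; induction N as [|N IH]; intros H.
- exists 0; split; [lra|intros; lia].
- destruct IH as (M & HM & HP); [intros; apply H; lia|].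
  destruct (H (S N) ltac:(lia)) as (M' & HM' & HP').
  exists (M + M'); split; [lra|]; intros n Hn.
  destruct (Nat.eq_dec n (S N)) as [->|Hne].
  + apply Hmono with M'; [lra|assumption].
  + apply Hmono with M; [lra|apply HP; lia].
Qed.

Lemma heat_res_minus a b K tau h T W T' W' i k :
  heat_res a b K tau h (fun i k => T i k - T' i k) (fun i k => W i k - W' i k) i k
  = heat_res a b K tau h T W i k - heat_res a b K tau h T' W' i k.
Proof. unfold heat_res, delta2, delta, mid, Rdiv; ring. Qed.

Lemma right_res_minus a b K z0 tau h N Ms T W s T' W' s' k :
  right_res a b K z0 tau h N Ms (fun i k => T i k - T' i k)
    (fun i k => W i k - W' i k) (fun n k => s n k - s' n k) k
  = right_res a b K z0 tau h N Ms T W s k - right_res a b K z0 tau h N Ms T' W' s' k.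
Proof.
unfold right_res.
rewrite (sum_ext (fun n => _ * mid (fun k => s n k - s' n k) k)
  (fun n => coef_a N n / coef_b N n * mid (s n) k
            - coef_a N n / coef_b N n * mid (s' n) k))
  by (intros; unfold mid, Rdiv; ring).
rewrite sum_sub; unfold delta, mid, Rdiv; ring.
Qed.

Lemma zeta_res_minus a b z0 tau N Ms W Z s W' Z' s' n k :
  zeta_res a b z0 tau N Ms (fun i k => W i k - W' i k)
    (fun n k => Z n k - Z' n k) (fun n k => s n k - s' n k) n k
  = zeta_res a b z0 tau N Ms W Z s n k - zeta_res a b z0 tau N Ms W' Z' s' n k.
Proof. unfold zeta_res, delta, mid, Rdiv; ring. Qed.

Lemma compat_res_minus tau h T W T' W' i k :
  compat_res tau h (fun i k => T i k - T' i k) (fun i k => W i k - W' i k) i k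
  = compat_res tau h T W i k - compat_res tau h T' W' i k.
Proof. unfold compat_res, delta, mid, Rdiv; ring. Qed.

Lemma sigma_res_minus tau Z s Z' s' n k :
  sigma_res tau (fun n k => Z n k - Z' n k) (fun n k => s n k - s' n k) n k
  = sigma_res tau Z s n k - sigma_res tau Z' s' n k.
Proof. unfold sigma_res, delta, mid, Rdiv; ring. Qed.

Section Consistency.
Variables (a b K D x_r z0 : R) (N : nat).
Hypotheses (Ha : 0 < a) (Hb : 0 < b) (HK : 0 < K) (HD : 0 < D) (Hxr : 0 < x_r).
Variables (F : R -> R -> R) (Q Rt : R -> R) (T : R -> R -> R) (zeta : nat -> R -> R).
Hypothesis HT : C_rectangle 5 x_r D T.

Let W := partial_t D T.
Let Wt := partial_t D W.
Let Tx := partial_x x_r T.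
Let Wx := partial_x x_r W.
Let Txx := partial_x x_r Tx.
Let Wxx := partial_x x_r Wx.
Let zeta' n := Derive_within 0 D (zeta n).
Let zeta'' n := Derive_within 0 D (zeta' n).

Let HW : C_rectangle 4 x_r D W.
Proof. exact (C_rectangle_pt _ _ _ _ HT). Qed.

Let HT4 : C_rectangle 4 x_r D T.
Proof. apply C_rectangle_S; exact HT. Qed.

Hypothesis heat : forall x t, 0 <= x <= x_r -> 0 <= t <= D ->
  W x t + a * Wt x t = K * (Txx x t + b * Wxx x t) + F x t.

(** The equation holds at both time levels, so its mean involves [T_xx] and [T_txx]
    without time error; only [a T_tt] is replaced by a difference quotient. *)
Lemma heat_consistent : exists M, 0 <= M /\
  forall Mt Ms i k, (1 <= Mt)%nat -> (1 <= k <= Mt)%nat -> (1 <= i <= Ms - 1)%nat ->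
  let tau := D / INR Mt in let h := x_r / INR Ms in
  Rabs (heat_res a b K tau h (on_grid h tau T) (on_grid h tau W) i k
        - mid (fun l => F (INR i * h) (INR l * tau)) k) <= M * (tau ^ 2 + h ^ 2).
Proof.
destruct (central_difference_consistent x_r D Hxr T HT4) as (M1 & HM1 & B1).
destruct (central_difference_consistent x_r D Hxr W HW) as (M2 & HM2 & B2).
destruct (trapezoid_consistent x_r D HD W (C_rectangle_S _ _ _ _ HW)) as (M3 & HM3 & B3).
fold Tx Txx in B1; fold Wx Wxx in B2; fold Wt in B3.
exists (a * M3 + K * (M1 + b * M2)); split.
{ repeat first [assumption | lra | apply Rplus_le_le_0_compat | apply Rmult_le_pos]. }
intros Mt Ms i k HMt Hk Hi tau h.
assert (Hx := grid_point x_r Ms i Hxr ltac:(lia) ltac:(lia)).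
assert (Ht1 := grid_point D Mt k HD HMt (proj2 Hk)).
assert (Ht0 := grid_point D Mt (k - 1) HD HMt ltac:(lia)).
assert (Hh : 0 < h) by (apply Rdiv_lt_0_compat; [lra|apply lt_0_INR; lia]).
assert (Htau : 0 < tau) by (apply Rdiv_lt_0_compat; [lra|apply lt_0_INR; lia]).
assert (A1 := B1 Ms i _ Hi Ht1); assert (A0 := B1 Ms i _ Hi Ht0).
assert (E1 := B2 Ms i _ Hi Ht1); assert (E0 := B2 Ms i _ Hi Ht0).
assert (G := B3 Mt k _ HMt Hk Hx).
assert (F1 := heat _ _ Hx Ht1); assert (F0 := heat _ _ Hx Ht0).
cbv zeta in A1, A0, E1, E0, G; fold tau h in Hx, A1, A0, E1, E0, G, F1, F0.
set (rA1 := _ - _) in A1; set (rA0 := _ - _) in A0.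
set (rE1 := _ - _) in E1; set (rE0 := _ - _) in E0; set (rG := _ - _) in G.
match goal with |- Rabs ?X <= _ => replace X with
  (- a * rG + (- K * ((rA1 + rA0) / 2) + - (K * b) * ((rE1 + rE0) / 2))) end.
2: { unfold mid at 1; symmetry.
     replace (F (INR i * h) (INR k * tau)) with
       (W (INR i * h) (INR k * tau) + a * Wt (INR i * h) (INR k * tau)
        - K * (Txx (INR i * h) (INR k * tau) + b * Wxx (INR i * h) (INR k * tau)))
       by lra.
     replace (F (INR i * h) (INR (k - 1) * tau)) with
       (W (INR i * h) (INR (k - 1) * tau) + a * Wt (INR i * h) (INR (k - 1) * tau)
        - K * (Txx (INR i * h) (INR (k - 1) * tau)
               + b * Wxx (INR i * h) (INR (k - 1) * tau)))
       by lra.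
     unfold heat_res, rG, rA1, rA0, rE1, rE0, on_grid, delta2, delta, mid; field; lra. }
assert (A : Rabs ((rA1 + rA0) / 2) <= M1 * h ^ 2).
{ unfold Rdiv; rewrite Rmult_comm; eapply Rle_trans;
    [apply Rabs_mul_le, Rabs_add_le; [apply A1|apply A0]|].
  rewrite Rabs_pos_eq by lra; lra. }
assert (E : Rabs ((rE1 + rE0) / 2) <= M2 * h ^ 2).
{ unfold Rdiv; rewrite Rmult_comm; eapply Rle_trans;
    [apply Rabs_mul_le, Rabs_add_le; [apply E1|apply E0]|].
  rewrite Rabs_pos_eq by lra; lra. }
eapply Rle_trans;
  [apply Rabs_add_le; [|apply Rabs_add_le]; apply Rabs_mul_le; eassumption|].
assert (HKb : 0 < K * b) by (apply Rmult_lt_0_compat; lra).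
rewrite !Rabs_Ropp, !Rabs_pos_eq by lra.
pose proof (pow2_ge_0 tau); pose proof (pow2_ge_0 h).
assert (0 <= a * M3 * h ^ 2) by (apply Rmult_le_pos; [apply Rmult_le_pos|]; lra).
assert (0 <= K * (M1 + b * M2) * tau ^ 2).
{ assert (0 <= b * M2) by (apply Rmult_le_pos; lra).
  apply Rmult_le_pos; [apply Rmult_le_pos|]; lra. }
lra.
Qed.

Hypothesis right_bc : forall t, 0 <= t <= D ->
  Tx x_r t + b * Wx x_r t
  + sqrt (z0 / K) * ((1 + sum_ab N) * W x_r t
      - z0 * sum_n_m (fun n => coef_a N n / coef_b N n * zeta' n t) 1 N) = Q t.

(** Averaging the boundary condition over two time levels is exact in the terms
    with [W] and [zeta'].  The defects of the one-sided differences are [O(h)], and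
    the factor [h] makes them second order. *)
Lemma right_consistent : exists M, 0 <= M /\
  forall Mt Ms k, (1 <= Mt)%nat -> (1 <= k <= Mt)%nat -> (1 <= Ms)%nat ->
  let tau := D / INR Mt in let h := x_r / INR Ms in
  Rabs (h * (right_res a b K z0 tau h N Ms (on_grid h tau T) (on_grid h tau W)
               (on_mesh tau zeta') k
             - (2 * K / h * mid (fun l => Q (INR l * tau)) k
                + mid (fun l => F (INR Ms * h) (INR l * tau)) k)))
  <= M * (tau ^ 2 + h ^ 2).
Proof.
destruct (boundary_consistent x_r D Hxr T (C_rectangle_S _ _ _ _ HT4)) as (M1 & HM1 & B1).
destruct (boundary_consistent x_r D Hxr W (C_rectangle_S _ _ _ _ HW)) as (M2 & HM2 & B2).
destruct (trapezoid_consistent x_r D HD W (C_rectangle_S _ _ _ _ HW)) as (M3 & HM3 & B3).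
fold Tx Txx in B1; fold Wx Wxx in B2; fold Wt in B3.
exists (x_r * (a * M3) + K * (M1 + b * M2)); split.
{ repeat first [assumption | lra | apply Rplus_le_le_0_compat | apply Rmult_le_pos]. }
intros Mt Ms k HMt Hk HMs tau h.
assert (HMs' : 1 <= INR Ms) by (apply (le_INR 1); lia).
assert (Hx : 0 <= x_r <= x_r) by lra.
assert (Ht1 := grid_point D Mt k HD HMt (proj2 Hk)).
assert (Ht0 := grid_point D Mt (k - 1) HD HMt ltac:(lia)).
assert (Hh : 0 < h) by (apply Rdiv_lt_0_compat; lra).
assert (HE : INR Ms * h = x_r) by (unfold h; field; lra).
assert (Hhx : h <= x_r) by nra.
assert (Htau : 0 < tau) by (apply Rdiv_lt_0_compat; [lra|apply lt_0_INR; lia]).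
assert (A1 := B1 Ms _ HMs Ht1); assert (A0 := B1 Ms _ HMs Ht0).
assert (E1 := B2 Ms _ HMs Ht1); assert (E0 := B2 Ms _ HMs Ht0).
assert (G := B3 Mt k _ HMt Hk Hx).
assert (F1 := heat _ _ Hx Ht1); assert (F0 := heat _ _ Hx Ht0).
assert (Q1 := right_bc _ Ht1); assert (Q0 := right_bc _ Ht0).
cbv zeta in A1, A0, E1, E0, G; fold tau h in A1, A0, E1, E0, G, F1, F0, Q1, Q0.
set (rA1 := _ - _) in A1; set (rA0 := _ - _) in A0.
set (rE1 := _ - _) in E1; set (rE0 := _ - _) in E0; set (rG := _ - _) in G.
match goal with |- Rabs ?X <= _ => replace X with
  (h * (- a * rG + (- K * ((rA1 + rA0) / 2) + - (K * b) * ((rE1 + rE0) / 2)))) end.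
2: { f_equal; unfold mid at 1 2; rewrite HE, <- Q1, <- Q0; symmetry.
     replace (F x_r (INR k * tau)) with
       (W x_r (INR k * tau) + a * Wt x_r (INR k * tau)
        - K * (Txx x_r (INR k * tau) + b * Wxx x_r (INR k * tau))) by lra.
     replace (F x_r (INR (k - 1) * tau)) with
       (W x_r (INR (k - 1) * tau) + a * Wt x_r (INR (k - 1) * tau)
        - K * (Txx x_r (INR (k - 1) * tau) + b * Wxx x_r (INR (k - 1) * tau)))
       by lra.
     unfold right_res; rewrite sum_mid.
     unfold rG, rA1, rA0, rE1, rE0, on_grid, on_mesh, delta, mid.
     rewrite HE; field; lra. }
assert (A : Rabs ((rA1 + rA0) / 2) <= M1 * h).
{ unfold Rdiv; rewrite Rmult_comm; eapply Rle_trans;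
    [apply Rabs_mul_le, Rabs_add_le; [apply A1|apply A0]|].
  rewrite Rabs_pos_eq by lra; lra. }
assert (E : Rabs ((rE1 + rE0) / 2) <= M2 * h).
{ unfold Rdiv; rewrite Rmult_comm; eapply Rle_trans;
    [apply Rabs_mul_le, Rabs_add_le; [apply E1|apply E0]|].
  rewrite Rabs_pos_eq by lra; lra. }
eapply Rle_trans;
  [apply Rabs_mul_le, Rabs_add_le; [|apply Rabs_add_le]; apply Rabs_mul_le; eassumption|].
assert (HKb : 0 < K * b) by (apply Rmult_lt_0_compat; lra).
rewrite !Rabs_Ropp, !Rabs_pos_eq by lra.
pose proof (pow2_ge_0 tau); pose proof (pow2_ge_0 h).
assert (HaM : 0 <= a * M3) by (apply Rmult_le_pos; lra).
assert (h * (a * M3 * tau ^ 2) <= x_r * (a * M3 * tau ^ 2)).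
{ apply Rmult_le_compat_r; [apply Rmult_le_pos|]; lra. }
assert (0 <= x_r * (a * M3) * h ^ 2)
  by (apply Rmult_le_pos; [apply Rmult_le_pos|]; lra).
assert (0 <= K * (M1 + b * M2) * tau ^ 2).
{ assert (0 <= b * M2) by (apply Rmult_le_pos; lra).
  apply Rmult_le_pos; [apply Rmult_le_pos|]; lra. }
lra.
Qed.

Hypothesis Hzeta : forall n, (1 <= n <= N)%nat -> C_interval 4 0 D (zeta n).
Hypothesis zeta_eq : forall n t, (1 <= n <= N)%nat -> 0 <= t <= D ->
  (z0 - coef_b N n * z0) * zeta' n t
  + coef_b N n * (zeta n t + (a + b) * zeta' n t + a * b * zeta'' n t)
  = W x_r t + Rt t.

Lemma zeta_consistent : exists M, 0 <= M /\
  forall n, (1 <= n <= N)%nat -> forall Mt Ms k,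
  (1 <= Mt)%nat -> (1 <= k <= Mt)%nat -> (1 <= Ms)%nat ->
  let tau := D / INR Mt in let h := x_r / INR Ms in
  Rabs (zeta_res a b z0 tau N Ms (on_grid h tau W) (on_mesh tau zeta)
          (on_mesh tau zeta') n k - mid (fun l => Rt (INR l * tau)) k)
  <= M * tau ^ 2.
Proof.
apply uniform_bound.
{ intros n M M' HMM HP Mt Ms k HMt Hk HMs tau h.
  eapply Rle_trans; [apply (HP Mt Ms k HMt Hk HMs)|].
  apply Rmult_le_compat_r; [apply pow2_ge_0|assumption]. }
intros n Hn.
destruct (Hzeta n Hn) as (_ & _ & Hz').
destruct (trapezoid_consistent_1d D HD 0 _ Hz') as (M & HM & B).
exists (Rabs (- (coef_b N n * a * b)) * M); split.
{ apply Rmult_le_pos; [apply Rabs_pos|assumption]. }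
intros Mt Ms k HMt Hk HMs tau h.
assert (HMs' : 0 < INR Ms) by (apply lt_0_INR; lia).
assert (HE : INR Ms * h = x_r) by (unfold h; field; lra).
assert (Htau : 0 < tau) by (apply Rdiv_lt_0_compat; [lra|apply lt_0_INR; lia]).
assert (Ht1 := grid_point D Mt k HD HMt (proj2 Hk)).
assert (Ht0 := grid_point D Mt (k - 1) HD HMt ltac:(lia)).
assert (Q1 := zeta_eq n _ Hn Ht1); assert (Q0 := zeta_eq n _ Hn Ht0).
assert (G := B Mt k HMt Hk).
cbv zeta in G; fold tau in G, Q1, Q0; fold (zeta' n) in G; fold (zeta'' n) in G.
apply (Rabs_mul_le (- (coef_b N n * a * b))) in G.
rewrite Rmult_assoc; eapply Rle_trans; [right|apply G].
unfold mid at 1.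
replace (Rt (INR k * tau)) with ((z0 - coef_b N n * z0) * zeta' n (INR k * tau)
  + coef_b N n * (zeta n (INR k * tau) + (a + b) * zeta' n (INR k * tau)
                  + a * b * zeta'' n (INR k * tau)) - W x_r (INR k * tau)) by lra.
replace (Rt (INR (k - 1) * tau)) with ((z0 - coef_b N n * z0) * zeta' n (INR (k - 1) * tau)
  + coef_b N n * (zeta n (INR (k - 1) * tau) + (a + b) * zeta' n (INR (k - 1) * tau)
                  + a * b * zeta'' n (INR (k - 1) * tau)) - W x_r (INR (k - 1) * tau)) by lra.
unfold zeta_res, on_grid, on_mesh, delta, mid; rewrite HE; f_equal; field; lra.
Qed.

Lemma sigma_consistent : exists M, 0 <= M /\
  forall n, (1 <= n <= N)%nat -> forall Mt k,
  (1 <= Mt)%nat -> (1 <= k <= Mt)%nat ->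
  let tau := D / INR Mt in
  Rabs (sigma_res tau (on_mesh tau zeta) (on_mesh tau zeta') n k) <= M * tau ^ 2.
Proof.
apply uniform_bound.
{ intros n M M' HMM HP Mt k HMt Hk tau.
  eapply Rle_trans; [apply (HP Mt k HMt Hk)|].
  apply Rmult_le_compat_r; [apply pow2_ge_0|assumption]. }
intros n Hn; exact (trapezoid_consistent_1d D HD 1 _ (Hzeta n Hn)).
Qed.
End Consistency.

(** * Convergence *)

Lemma sup_norm_attained M u : exists i, (i <= M)%nat /\ sup_norm M u = Rabs (u i).
Proof.
assert (HI : In (sup_norm M u) (map (fun i => Rabs (u i)) (seq 0 (S M)))).
{ apply MaxRlist_P2; exists (Rabs (u 0%nat)); simpl; auto. }
apply in_map_iff in HI; destruct HI as (i & <- & Hi).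
apply in_seq in Hi; exists i; split; [lia|reflexivity].
Qed.

Lemma fd_scheme_residuals {a b K D x_r z0 N F xi1 eta1 Q Rt Mt Ms Tb Wb Z sigma} :
  fd_scheme a b K D x_r z0 N F xi1 eta1 Q Rt Mt Ms Tb Wb Z sigma ->
  let tau := D / INR Mt in let h := x_r / INR Ms in
  (forall i k, (1 <= i <= Ms - 1)%nat -> (1 <= k <= Mt)%nat ->
     heat_res a b K tau h Tb Wb i k = mid (fun l => F (INR i * h) (INR l * tau)) k) /\
  (forall k, (1 <= k <= Mt)%nat ->
     right_res a b K z0 tau h N Ms Tb Wb sigma k
     = 2 * K / h * mid (fun l => Q (INR l * tau)) k
       + mid (fun l => F (INR Ms * h) (INR l * tau)) k) /\
  (forall n k, (1 <= n <= N)%nat -> (1 <= k <= Mt)%nat ->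
     zeta_res a b z0 tau N Ms Wb Z sigma n k = mid (fun l => Rt (INR l * tau)) k) /\
  (forall i k, (1 <= i <= Ms)%nat -> (1 <= k <= Mt)%nat ->
     compat_res tau h Tb Wb i k = 0) /\
  (forall n k, (1 <= n <= N)%nat -> (1 <= k <= Mt)%nat ->
     sigma_res tau Z sigma n k = 0).
Proof.
intros [Hheat _ _ Hright Hzeta _ HW Hsigma _] tau h; repeat split.
- intros i k Hi Hk; assert (X := Hheat i k Hi Hk).
  cbv zeta in X; fold tau h in X; unfold heat_res; rewrite X; ring.
- intros k Hk; assert (X := Hright k Hk).
  cbv zeta in X; fold tau h in X; unfold right_res; rewrite X; ring.
- intros n k Hn Hk; assert (X := Hzeta n k Hn Hk).
  cbv zeta in X; fold tau in X; unfold zeta_res; rewrite X; ring.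
- exact HW.
- exact Hsigma.
Qed.

Lemma Derive_within_zero D (HD : 0 < D) g t : (forall s, 0 <= s <= D -> g s = 0) ->
  0 <= t <= D -> Derive_within 0 D g t = 0.
Proof.
intros Hg Ht; apply Derive_within_unique; auto.
apply is_derive_within_eps; auto; intros eps; exists (mkposreal 1 Rlt_0_1).
intros s Hs _; rewrite !Hg by assumption.
replace (0 - 0 - (s - t) * 0) with 0 by ring; rewrite Rabs_R0.
apply Rmult_le_pos; [left; apply cond_pos|apply Rabs_pos].
Qed.

Theorem theorem3p2
  (a b K D x_r z0 : R) (N : nat)
  (a_pos : 0 < a) (b_pos : 0 < b) (K_pos : 0 < K) (D_pos : 0 < D)
  (x_r_pos : 0 < x_r) (z0_pos : 0 < z0) (N_pos : (1 <= N)%nat)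
  (f : R -> R -> R) (xi eta phi : R -> R)
  (f_cont : continuous_on (fun p : R * R => 0 <= fst p /\ 0 <= snd p <= D)
              (fun p => f (fst p) (snd p)))
  (f_supp : forall x t, ~ (0 <= x <= x_r /\ 0 <= t <= D) -> f x t = 0)
  (xi_cont : continuous_on (fun x => 0 <= x) xi)
  (xi_supp : forall x, ~ (0 <= x <= x_r) -> xi x = 0)
  (eta_cont : continuous_on (fun x => 0 <= x) eta)
  (eta_supp : forall x, ~ (0 <= x <= x_r) -> eta x = 0)
  (phi_C2 : C_interval 2 0 D phi)
  (T : R -> R -> R) (zeta : nat -> R -> R)
  (T_smooth : C_rectangle 5 x_r D T)
  (zeta_smooth : forall n, (1 <= n <= N)%nat -> C_interval 4 0 D (zeta n))
  (T_sol : reduced_problem a b K D x_r z0 N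
             (data_F a D f phi) (data_xi1 xi phi) (data_eta1 D eta phi)
             (data_Q K D z0 N phi) (data_R D phi) T zeta) :
  exists C : R, 0 < C /\
    forall Mt Ms : nat, (1 <= Mt)%nat -> (1 <= Ms)%nat ->
    forall Tb Wb Z sigma : nat -> nat -> R,
    fd_scheme a b K D x_r z0 N
      (data_F a D f phi) (data_xi1 xi phi) (data_eta1 D eta phi)
      (data_Q K D z0 N phi) (data_R D phi) Mt Ms Tb Wb Z sigma ->
    let dt := D / INR Mt in
    let h := x_r / INR Ms in
    forall m : nat, (1 <= m <= Mt)%nat ->
    (sup_norm Ms (fun i => T (INR i * h) (INR m * dt) - Tb i m)) ^ 2
    <= C * (dt ^ 4 + h ^ 4).
Proof.
destruct T_sol as [Pheat Pinit Pinit_t Pleft Pright Pzeta Pzinit].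
set (F := data_F a D f phi) in *; set (Q := data_Q K D z0 N phi) in *.
set (Rt := data_R D phi) in *.
set (W := partial_t D T) in *.
assert (W4 : C_rectangle 4 x_r D W) by exact (C_rectangle_pt _ _ _ _ T_smooth).
assert (Wt3 := C_rectangle_pt _ _ _ _ W4); assert (Wx3 := C_rectangle_px _ _ _ _ W4).
assert (Wxx2 := C_rectangle_px _ _ _ _ Wx3).
assert (Tx4 := C_rectangle_px _ _ _ _ T_smooth).
assert (Txx3 := C_rectangle_px _ _ _ _ Tx4).
set (I := fun t => 0 <= t <= D).
assert (cphi : continuous_on I (Derive_within 0 D phi) /\
               continuous_on I (Derive_within 0 D (Derive_within 0 D phi))).
{ destruct phi_C2 as (_ & _ & c1 & _ & c2 & _); split; assumption. }
destruct cphi as [cphi1 cphi2].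
(* The mean of an equation over the first time step involves [t = 0], where it
   holds by continuity. *)
assert (Heat : forall x t, 0 <= x <= x_r -> 0 <= t <= D ->
  W x t + a * partial_t D W x t
  = K * (partial_x x_r (partial_x x_r T) x t + b * partial_x x_r (partial_x x_r W) x t)
    + F x t).
{ intros x t Hx Ht.
  assert (X := zero_at_left_end D (fun t => W x t + a * partial_t D W x t
    + - K * partial_x x_r (partial_x x_r T) x t
    + - (K * b) * partial_x x_r (partial_x x_r W) x t
    + - 1 * f x t + 1 * Derive_within 0 D phi t
    + a * Derive_within 0 D (Derive_within 0 D phi) t) D_pos).
  cbv beta in X.
  enough (E : W x t + a * partial_t D W x t
    + - K * partial_x x_r (partial_x x_r T) x t
    + - (K * b) * partial_x x_r (partial_x x_r W) x t
    + - 1 * f x t + 1 * Derive_within 0 D phi t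
    + a * Derive_within 0 D (Derive_within 0 D phi) t = 0)
    by (unfold F, data_F; lra).
  apply X; [| |exact Ht].
  - assert (cf : continuous_on I (f x)).
    { apply (continuous_on_slice _ I _ x f_cont); intros s Hs; split; [apply Hx|exact Hs]. }
    apply continuous_on_lincomb; [|exact cphi2].
    apply continuous_on_lincomb; [|exact cphi1].
    apply continuous_on_lincomb; [|exact cf].
    apply continuous_on_lincomb; [|exact (C_rectangle_continuous_t _ _ _ _ x Wxx2 Hx)].
    apply continuous_on_lincomb; [|exact (C_rectangle_continuous_t _ _ _ _ x Txx3 Hx)].
    apply continuous_on_lincomb; [|exact (C_rectangle_continuous_t _ _ _ _ x Wt3 Hx)].
    exact (C_rectangle_continuous_t _ _ _ _ x W4 Hx).
  - intros s Hs; assert (Y := Pheat x s Hx Hs); fold W in Y.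
    unfold F, data_F in Y; lra. }
set (gam := sqrt (z0 / K)) in *.
assert (Czeta : forall n, (1 <= n <= N)%nat ->
  continuous_on I (zeta n) /\ continuous_on I (Derive_within 0 D (zeta n)) /\
  continuous_on I (Derive_within 0 D (Derive_within 0 D (zeta n)))).
{ intros n Hn; destruct (zeta_smooth n Hn) as (c0 & _ & c1 & _ & c2 & _); auto. }
assert (Right : forall t, 0 <= t <= D ->
  partial_x x_r T x_r t + b * partial_x x_r W x_r t
  + gam * ((1 + sum_ab N) * W x_r t
      - z0 * sum_n_m (fun n => coef_a N n / coef_b N n
                            * Derive_within 0 D (zeta n) t) 1 N) = Q t).
{ intros t Ht.
  assert (X := zero_at_left_end D (fun t => partial_x x_r T x_r t
    + b * partial_x x_r W x_r t + gam * (1 + sum_ab N) * W x_r t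
    + - (gam * z0) * sum_n_m (fun n => coef_a N n / coef_b N n
                            * Derive_within 0 D (zeta n) t) 1 N
    + gam * (1 + sum_ab N) * Derive_within 0 D phi t) D_pos).
  cbv beta in X.
  assert (Hr : 0 <= x_r <= x_r) by lra.
  enough (E : partial_x x_r T x_r t
    + b * partial_x x_r W x_r t + gam * (1 + sum_ab N) * W x_r t
    + - (gam * z0) * sum_n_m (fun n => coef_a N n / coef_b N n
                            * Derive_within 0 D (zeta n) t) 1 N
    + gam * (1 + sum_ab N) * Derive_within 0 D phi t = 0)
    by (unfold Q, data_Q; fold gam; lra).
  apply X; [| |exact Ht].
  - apply continuous_on_lincomb; [|exact cphi1].
    apply continuous_on_lincomb;
      [|apply continuous_on_sum; intros n Hn; apply (Czeta n Hn)].
    apply continuous_on_lincomb; [|exact (C_rectangle_continuous_t _ _ _ _ x_r W4 Hr)].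
    apply continuous_on_lincomb; [|exact (C_rectangle_continuous_t _ _ _ _ x_r Wx3 Hr)].
    exact (C_rectangle_continuous_t _ _ _ _ x_r Tx4 Hr).
  - intros s Hs; assert (Y := Pright s Hs).
    unfold Q, data_Q in Y; fold gam in Y; lra. }
assert (Zeta : forall n t, (1 <= n <= N)%nat -> 0 <= t <= D ->
  (z0 - coef_b N n * z0) * Derive_within 0 D (zeta n) t
  + coef_b N n * (zeta n t + (a + b) * Derive_within 0 D (zeta n) t
      + a * b * Derive_within 0 D (Derive_within 0 D (zeta n)) t)
  = W x_r t + Rt t).
{ intros n t Hn Ht; destruct (Czeta n Hn) as (c0 & c1 & c2).
  assert (X := zero_at_left_end D (fun t => W x_r t
    + 1 * Derive_within 0 D phi t
    + - (z0 - coef_b N n * z0 + coef_b N n * (a + b)) * Derive_within 0 D (zeta n) t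
    + - coef_b N n * zeta n t
    + - (coef_b N n * (a * b)) * Derive_within 0 D (Derive_within 0 D (zeta n)) t) D_pos).
  cbv beta in X.
  assert (Hr : 0 <= x_r <= x_r) by lra.
  enough (E : W x_r t + 1 * Derive_within 0 D phi t
    + - (z0 - coef_b N n * z0 + coef_b N n * (a + b)) * Derive_within 0 D (zeta n) t
    + - coef_b N n * zeta n t
    + - (coef_b N n * (a * b)) * Derive_within 0 D (Derive_within 0 D (zeta n)) t = 0)
    by (unfold Rt, data_R; lra).
  apply X; [| |exact Ht].
  - apply continuous_on_lincomb; [|exact c2].
    apply continuous_on_lincomb; [|exact c0].
    apply continuous_on_lincomb; [|exact c1].
    apply continuous_on_lincomb; [|exact cphi1].
    exact (C_rectangle_continuous_t _ _ _ _ x_r W4 Hr).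
  - intros s Hs; assert (Y := Pzeta n s Hn Hs); unfold Rt, data_R in Y; lra. }
assert (Left : forall t, 0 <= t <= D -> T 0 t = 0 /\ W 0 t = 0).
{ assert (H0 : 0 <= 0 <= x_r) by lra.
  assert (X := zero_at_left_end D (T 0) D_pos
    (C_rectangle_continuous_t _ _ _ T 0 T_smooth H0) Pleft).
  intros t Ht; split; [auto|]; apply (Derive_within_zero D D_pos (T 0)); auto. }
destruct (heat_consistent a b K D x_r a_pos b_pos K_pos D_pos x_r_pos F T T_smooth Heat)
  as (M1 & HM1 & B1).
destruct (right_consistent a b K D x_r z0 N a_pos b_pos K_pos D_pos x_r_pos F Q T zeta
  T_smooth Heat Right) as (M2 & HM2 & B2).
destruct (zeta_consistent a b D x_r z0 N D_pos Rt T zeta zeta_smooth Zeta)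
  as (M3 & HM3 & B3).
destruct (sigma_consistent D N D_pos zeta zeta_smooth) as (M4 & HM4 & B4).
destruct (mixed_consistent x_r D x_r_pos D_pos T (C_rectangle_S _ _ _ _ T_smooth))
  as (M5 & HM5 & B5).
destruct (stability a b K z0 D x_r N a_pos b_pos K_pos z0_pos D_pos x_r_pos)
  as (C0 & HC0 & Hstab).
(* The summand 1 keeps the final constant positive. *)
set (M := 1 + M1 + M2 + M3 + M4 + M5).
exists (C0 * (M ^ 2 * 2)); split.
{ assert (0 < M) by (unfold M; lra).
  apply Rmult_lt_0_compat; [assumption|]; apply Rmult_lt_0_compat; [|lra].
  apply pow_lt; assumption. }
intros Mt Ms HMt HMs Tb Wb Z sigma Hfd tau h m Hm.
destruct (fd_scheme_residuals Hfd) as (R1 & R2 & R3 & R4 & R5).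
fold tau h in R1, R2, R3, R4, R5.
destruct Hfd as [_ Hinit _ _ _ Hzinit _ _ HV].
assert (P1 := pow2_ge_0 tau); assert (P2 := pow2_ge_0 h).
set (eps := M * (tau ^ 2 + h ^ 2)).
assert (Heps : forall X c, 0 <= c <= M -> X <= c * (tau ^ 2 + h ^ 2) -> X <= eps).
{ intros X c Hc HX; eapply Rle_trans; [apply HX|]; apply Rmult_le_compat_r; lra. }
assert (Heps' : forall X c, 0 <= c <= M -> X <= c * tau ^ 2 -> X <= eps).
{ intros X c Hc HX; apply (Heps X c Hc); eapply Rle_trans; [apply HX|].
  apply Rmult_le_compat_l; lra. }
assert (Res : small_residuals a b K z0 tau h eps N Mt Ms
  (fun i k => on_grid h tau T i k - Tb i k) (fun i k => on_grid h tau W i k - Wb i k)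
  (fun n k => on_mesh tau zeta n k - Z n k)
  (fun n k => on_mesh tau (fun n => Derive_within 0 D (zeta n)) n k - sigma n k)).
{ split.
  - intros i k Hi Hk; rewrite heat_res_minus, R1 by assumption.
    apply (Heps _ M1); [unfold M; lra|]; apply B1; auto.
  - intros k Hk; rewrite right_res_minus, R2 by assumption.
    apply (Heps _ M2); [unfold M; lra|]; apply B2; auto.
  - intros n k Hn Hk; rewrite zeta_res_minus, R3 by assumption.
    apply (Heps' _ M3); [unfold M; lra|]; apply B3; auto.
  - intros i k Hi Hk; rewrite compat_res_minus, R4, Rminus_0_r by assumption.
    apply (Heps' _ M5); [unfold M; lra|]; apply B5; auto.
  - intros n k Hn Hk; rewrite sigma_res_minus, R5, Rminus_0_r by assumption.
    apply (Heps' _ M4); [unfold M; lra|]; apply B4; auto.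
  - intros i Hi.
    destruct (Hinit i Hi) as [-> ->].
    assert (Hx := grid_point x_r Ms i x_r_pos HMs Hi); fold h in Hx |- *.
    unfold on_grid; simpl (INR 0); rewrite Rmult_0_l.
    rewrite (Pinit _ Hx), (Pinit_t _ Hx); split; ring.
  - intros n Hn; unfold on_mesh; simpl (INR 0); rewrite Rmult_0_l.
    destruct (Pzinit n Hn) as [-> ->].
    destruct (Hzinit n Hn) as [-> ->].
    split; ring.
  - intros k Hk; unfold on_grid; simpl (INR 0); rewrite Rmult_0_l.
    destruct (Left _ (grid_point D Mt k D_pos HMt Hk)) as [E1 E2]; fold tau in E1, E2.
    destruct (HV k Hk) as [E3 E4].
    rewrite E1, E2, E3, E4; split; ring. }
destruct (sup_norm_attained Ms (fun i => T (INR i * h) (INR m * tau) - Tb i m))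
  as (i & Hi & ->).
rewrite pow2_abs.
eapply Rle_trans; [exact (Hstab Mt Ms HMt HMs _ _ _ _ _ Res i m Hi (proj2 Hm))|].
rewrite Rmult_assoc; apply Rmult_le_compat_l; [lra|].
unfold eps; rewrite Rpow_mult_distr, Rmult_assoc.
apply Rmult_le_compat_l; [apply pow2_ge_0|].
pose proof (pow2_ge_0 (tau ^ 2 - h ^ 2)); nra.
Qed.
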